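(* Let $g_0\in G$ and let $\lambda$ be a Borel probability measure on $\mathcal X$ that is admissible with respect to $\varphi^{g_0}_t$. Let $\mathcal A_1,\dots,\mathcal A_r\subset\mathbb R^k$ be bounded Borel sets with $\mathrm{vol}_{\mathbb R^k}(\partial\mathcal A_i)=0$ and $N\in\mathbb Z_{\ge0}^r$. Then $$\lim_{L\to\infty}\lambda\big(\{x:\#\{j:L^{-n/k}\xi^{g_0}_j(x,L)\in\mathcal A_i\}=N_i\ \forall i\}\big)=\mu\big(\{\Gamma g:\#(\widehat{\mathbb Z}^ng\cap\mathcal C(\mathcal A_i,\mathcal W))=N_i\ \forall i\}\big).$$ In particular, for every $X>0$, $\lim_{L\to\infty}\lambda(\{x:L^{-n/k}|\xi^{g_0}_1(x,L)|>X\})=\mu(\{\Gamma g:\widehat{\mathbb Z}^ng\cap\mathcal C(B^k_X,\mathcal W)=\emptyset\})$.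
   Context: Fix integers $k\ge1$, $m\ge0$, $n=k+m+1$; $G=\mathrm{SL}(n,\mathbb R)$, $\Gamma=\mathrm{SL}(n,\mathbb Z)$, $\mathcal X=\Gamma\backslash G$, $\mu$ the right-$G$-invariant probability measure on $\mathcal X$. Row vectors $y=(y',y'',y_n)\in\mathbb R^k\times\mathbb R^m\times\mathbb R$, right action; $\widehat{\mathbb Z}^n$ primitive integer vectors. $U(s)=\begin{pmatrix}1_k&0&0\\0&1_m&0\\-s&0&1\end{pmatrix}$ ($s\in\mathbb R^k$, middle block absent if $m=0$); $\Phi(t)=\mathrm{diag}(e^{(m+1)t}1_k,e^{-kt}1_m,e^{-kt})$. For $g_0\in G$: $h^{g_0}_s(x)=xg_0U(s)g_0^{-1}$, $\varphi^{g_0}_t(x)=xg_0\Phi(t)g_0^{-1}$; $\lambda$ is admissible with respect to $\varphi^{g_0}_t$ if $\lim_{t\to\infty}\lambda(\varphi^{g_0}_tE)=\mu(E)$ for every Borel $E\subset\mathcal X$ with $\mu(\partial E)=0$. Fix a norm $|\cdot|$ on $\mathbb R^k$, $B^k_X$ its closed balls. Let $\mathcal W\subset\mathbb R^m\times\mathbb R_{>0}$ be bounded Borel with non-empty interior and Lebesgue-null boundary; $\mathcal C(\mathcal A,\mathcal W)=\{y:y'\in y_n\mathcal A,(y'',y_n)\in\mathcal W\}$. For $x=\Gamma g$, $L>0$, the hitting times $\xi_1(x,L),\xi_2(x,L),\dots$ list with multiplicity the multiset $\{v'/v_n:v\in\widehat{\mathbb Z}^ng,(v'',v_n)\in L^{-1}\mathcal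 W\}$ ordered by nondecreasing $|\cdot|$ (the times the orbit $xU(s)$ meets the section $\Gamma\backslash\Gamma H\{R(w):w\in L^{-1}\mathcal W\}$); and $\xi^{g_0}_j(x,L):=\xi_j(xg_0,L)$ are the hitting times of $h^{g_0}_s(x)$ with the conjugated section (its image under right multiplication by $g_0^{-1}$). $|\xi^{g_0}_1|=\infty$ if none exists. *)

(* Defs.v *)
From HB Require Import structures.
From mathcomp Require Import all_boot all_order all_algebra.
From mathcomp Require Import all_classical all_reals all_analysis.
Set Implicit Arguments. Unset Strict Implicit. Unset Printing Implicit Defensive.
Import Order.TTheory GRing.Theory Num.Theory.
Import numFieldNormedType.Exports.
Local Open Scope classical_set_scope.
Local Open Scope ring_scope.

Definition SLset (R : realType) (n : nat) : set 'M[R]_n := [set M | \det M = 1].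

Lemma SLone_in (R : realType) (n : nat) : (1%:M : 'M[R]_n) \in @SLset R n.
Proof. by rewrite inE /SLset /= det1. Qed.

Definition SLone (R : realType) (n : nat) : set_type (@SLset R n) :=
  exist _ 1%:M (@SLone_in R n).

HB.instance Definition _ (R : realType) (n : nat) :=
  isPointed.Build (set_type (@SLset R n)) (@SLone R n).

(* G = SL(n,R), with the subspace topology (set_type topology of matrix_topology) *)
Notation SLn R n := (set_type (@SLset R n)).

Definition mx_of (R : realType) (n : nat) (g : SLn R n) : 'M[R]_n := proj1_sig g.

Definition intmx (R : realType) (n : nat) (a : 'M[int]_n) : 'M[R]_n :=
  map_mx (fun z : int => z%:~R) a.

Definition gamma_inv (R : realType) (n : nat) (A : set (SLn R n)) : Prop :=
  forall (gam : 'M[int]_n) (g y : SLn R n), \det gam = 1 ->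
    mx_of y = @intmx R n gam *m mx_of g -> A g -> A y.

(* ---------- The space X = Gamma \ G with its Borel sigma-algebra ----------
   Model: a Borel set of X is identified with its (left Gamma-invariant) preimage
   in G.  The Borel sigma-algebra of X is generated by the open sets of X, whose
   preimages are exactly the Gamma-invariant open subsets of G; hence we take the
   sigma-algebra on G generated by the Gamma-invariant open sets.  A point x = Gamma g
   of X is represented by any g in G. *)
Definition Xgen (R : realType) (n : nat) : set (set (SLn R n)) :=
  [set A : set (SLn R n) | open A /\ gamma_inv A].

Definition Xsp (R : realType) (n : nat) := g_sigma_algebraType (@Xgen R n).

(* boundary in X, computed on preimages in G (the projection G -> X is open) *)
Definition boundaryX (R : realType) (n : nat) (E : set (Xsp R n)) : set (Xsp R n) :=
  closure (E : set (SLn R n)) `\` interior (E : set (SLn R n)).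

Definition rmul (R : realType) (n : nat) (E : set (Xsp R n)) (h : 'M[R]_n)
  : set (Xsp R n) :=
  [set y | exists2 x, E x & mx_of y = mx_of x *m h].

Definition right_invariant (R : realType) (n : nat)
    (mu : probability (Xsp R n) R) : Prop :=
  forall (h : SLn R n) (E : set (Xsp R n)), measurable E ->
    mu (rmul E (mx_of h)) = mu E.

Definition Phi (R : realType) (k m : nat) (t : R) : 'M[R]_(k + m + 1) :=
  diag_mx (row_mx (row_mx (const_mx (expR ((m.+1)%:R * t)) : 'rV[R]_k)
                          (const_mx (expR (- (k%:R * t))) : 'rV[R]_m))
                  (const_mx (expR (- (k%:R * t))) : 'rV[R]_1)).

Definition phi_set (R : realType) (k m : nat) (g0 : SLn R (k + m + 1)) (t : R)
    (E : set (Xsp R (k + m + 1))) : set (Xsp R (k + m + 1)) :=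
  rmul E (mx_of g0 *m @Phi R k m t *m invmx (mx_of g0)).

Definition admissible (R : realType) (k m : nat)
    (mu lam : probability (Xsp R (k + m + 1)) R) (g0 : SLn R (k + m + 1)) : Prop :=
  forall E : set (Xsp R (k + m + 1)), measurable E -> mu (boundaryX E) = 0%E ->
    (fun t : R => lam (phi_set g0 t E)) @ +oo%R --> mu E.

Definition primitive (n : nat) (a : 'rV[int]_n) : Prop :=
  forall d : int, (forall i, (d %| a ord0 i)%Z) -> d = 1 \/ d = -1.

Definition prim_latt (R : realType) (n : nat) (g : 'M[R]_n) : set 'rV[R]_n :=
  [set v | exists2 a : 'rV[int]_n, primitive a & v = map_mx (fun z : int => z%:~R) a *m g].

Definition vp (R : realType) (k m : nat) (v : 'rV[R]_(k + m + 1)) : 'rV[R]_k :=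
  lsubmx (lsubmx v).
Definition vpp (R : realType) (k m : nat) (v : 'rV[R]_(k + m + 1)) : 'rV[R]_m :=
  rsubmx (lsubmx v).
Definition vn (R : realType) (k m : nat) (v : 'rV[R]_(k + m + 1)) : R :=
  rsubmx v 0 0.
Definition wpart (R : realType) (k m : nat) (v : 'rV[R]_(k + m + 1)) : 'rV[R]_(m + 1) :=
  row_mx (vpp v) (rsubmx v).
Definition lastc (R : realType) (m : nat) (w : 'rV[R]_(m + 1)) : R := rsubmx w 0 0.

Definition coneC (R : realType) (k m : nat) (A : set 'rV[R]_k) (W : set 'rV[R]_(m + 1))
  : set 'rV[R]_(k + m + 1) :=
  [set y | (exists2 a, A a & vp y = vn y *: a) /\ W (wpart y)].

(* ---------- Hitting times ----------
   The hitting times xi_j(Gamma g, L), listed with multiplicity, are indexed by the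
   vectors v in \widehat{Z}^n g with (v'', v_n) in L^{-1} W; the time attached to v is
   v'/v_n. *)
Definition hit_vectors (R : realType) (k m : nat) (g : 'M[R]_(k + m + 1)) (L : R)
    (W : set 'rV[R]_(m + 1)) : set 'rV[R]_(k + m + 1) :=
  [set v | prim_latt g v /\ exists2 w, W w & wpart v = L^-1 *: w].

Definition hit_time (R : realType) (k m : nat) (v : 'rV[R]_(k + m + 1)) : 'rV[R]_k :=
  (vn v)^-1 *: vp v.

Definition nk (k m : nat) (R : realType) : R := (k + m + 1)%:R / k%:R.

Definition hits_in (R : realType) (k m : nat) (g : 'M[R]_(k + m + 1)) (L : R)
    (W : set 'rV[R]_(m + 1)) (A : set 'rV[R]_k) : set 'rV[R]_(k + m + 1) :=
  [set v | hit_vectors g L W v /\ A ((L `^ (- nk k m R)) *: hit_time v)].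

(* |xi_1(g, L)| : the smallest norm of a hitting time (+oo if there is none) *)
Definition first_hit_norm (R : realType) (k m : nat) (nrm : 'rV[R]_k -> R)
    (g : 'M[R]_(k + m + 1)) (L : R) (W : set 'rV[R]_(m + 1)) : \bar R :=
  ereal_inf [set (nrm (hit_time v))%:E | v in hit_vectors g L W].

Definition is_norm (R : realType) (d : nat) (nrm : 'rV[R]_d -> R) : Prop :=
  [/\ forall x, nrm x = 0 -> x = 0,
      forall (c : R) x, nrm (c *: x) = `|c| * nrm x &
      forall x y, nrm (x + y) <= nrm x + nrm y].

Definition closed_ball_n (R : realType) (d : nat) (nrm : 'rV[R]_d -> R) (X : R)
  : set 'rV[R]_d := [set y | nrm y <= X].

Definition bounded_rv (R : realType) (d : nat) (A : set 'rV[R]_d) : Prop :=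
  exists M : R, forall x, A x -> forall i, `|x 0 i| <= M.

Definition borel_rv (R : realType) (d : nat) (A : set 'rV[R]_d) : Prop :=
  <<s [set U : set 'rV[R]_d | open U] >> A.

Definition boundary_rv (R : realType) (d : nat) (A : set 'rV[R]_d) : set 'rV[R]_d :=
  closure A `\` interior A.

Definition box_rv (R : realType) (d : nat) (a b : 'rV[R]_d) : set 'rV[R]_d :=
  [set x | forall i, a 0 i <= x 0 i <= b 0 i].
Definition vol_box (R : realType) (d : nat) (a b : 'rV[R]_d) : R :=
  \prod_(i < d) (b 0 i - a 0 i).
Definition leb_null (R : realType) (d : nat) (A : set 'rV[R]_d) : Prop :=
  forall eps : R, 0 < eps -> exists a b : nat -> 'rV[R]_d,
    [/\ forall j i, a j 0 i <= b j 0 i,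
        A `<=` \bigcup_j box_rv (a j) (b j) &
        forall N : nat, \sum_(j < N) vol_box (a j) (b j) < eps].

(* Main.v *)
(* Applying Phi(-t) with L = e^(kt) rescales the section to W and the hitting
   times by L^(-n/k), so the hitting condition on x says that x g0 Phi(-t) lies in
   the set of lattices with exactly N_i primitive vectors in each C(A_i, W).
   Admissibility then gives the limit, provided this set is Borel with mu-null
   boundary.

   Borel: for open D the condition #(primitive vectors in D) >= N is open and
   Gamma-invariant; a Dynkin argument extends measurability to bounded Borel D.

   Null boundary: lattice-point counts in C are locally constant at lattices
   avoiding the boundary of C, so it suffices that mu-almost no lattice has a
   primitive vector in a given bounded null piece of that boundary.  Instead of
   Siegel's formula, average over finitely many translates: for h_1, ..., h_T in
   a bounded part of G, right invariance gives
     mu{meets D} = integral of (1/T) #{j : the lattice of g h_j meets D},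
   and as the h_j fill out a grid of shears the integrand tends to 0 for every g,
   because only finitely many lattice vectors v can reach D, and v h_j
   equidistributes in directions in which D is Lebesgue null.  Dominated
   convergence concludes.  For norm balls the shears are replaced by Phi(s),
   whose orbits cross the boundary at most once. *)

Require Import Defs.
From HB Require Import structures.
From mathcomp Require Import all_boot all_order all_algebra.
From mathcomp Require Import perm.
From mathcomp Require Import all_classical all_reals all_analysis.
From mathcomp Require Import measurable_realfun.
From mathcomp Require Import ring lra zify.
Import Order.TTheory GRing.Theory Num.Theory.
Import numFieldNormedType.Exports.
Local Open Scope classical_set_scope.
Local Open Scope ring_scope.
Local Open Scope card_scope.

Set Implicit Arguments. Unset Strict Implicit. Unset Printing Implicit Defensive.

(** * Lattice points in bounded sets *)

Lemma normr_det_le (R : realType) (n : nat) (A : 'M[R]_n) (c : R) :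
  (forall i j, `|A i j| <= c) -> `|\det A| <= (n`!)%:R * c ^+ n.
Proof.
move=> Ac; apply: (le_trans (ler_norm_sum _ _ _)).
apply: (le_trans (y := \sum_(s : 'S_n) c ^+ n)); last first.
  by rewrite sumr_const card_Sn mulr_natl.
apply: ler_sum => s _; rewrite normrMsign normr_prod.
apply: (le_trans (y := \prod_(i < n) c)); last by rewrite prodr_const card_ord.
by apply: ler_prod => i _; rewrite normr_ge0 Ac.
Qed.

Definition lvec (R : realType) (n : nat) (a : 'rV[int]_n) (g : 'M[R]_n) : 'rV[R]_n :=
  map_mx (fun z : int => z%:~R) a *m g.

Lemma finite_int_box (n : nat) (K : nat) :
  finite_set [set a : 'rV[int]_n | forall i, (`|a 0%R i| <= K)%N].
Proof.
(* Coordinates in [[-K, K]] are shifted by [K] to one of the [2K+1] ordinals. *)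
pose f (x : 'rV['I_(K + K).+1]_n) : 'rV[int]_n := \row_i ((x 0 i)%:Z - K%:Z).
apply: (@sub_finite_set _ _ [set f x | x in [set: 'rV['I_(K + K).+1]_n]]).
  move=> a /= aK; exists (\row_i inord (absz (a 0%R i + K%:Z))) => //.
  apply/rowP => i; rewrite !mxE inordK; last by have := aK i; lia.
  by have := aK i; lia.
exact/finite_image/finite_finset.
Qed.

(** The coefficients are recovered as [a = (a g) adj g], and the entries of the adjugate are minors
    of size [n-1], at most [(n-1)! c^(n-1)] by the Leibniz formula. The finite set depends only on
    [c] and [q], so a single one serves a whole neighbourhood of a lattice or a whole bounded family
    of translates. *)
Lemma finite_lattice (R : realType) (n : nat) (c q : R) :
  exists2 F : set 'rV[int]_n, finite_set F &
    forall g : 'M[R]_n, \det g = 1 -> (forall i j, `|g i j| <= c) ->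
    forall a, (forall i, `|lvec a g 0 i| <= q) -> F a.
Proof.
pose d : R := (n.-1)`!%:R * c ^+ n.-1.
pose K := (Num.truncn (n%:R * (q * d))).
exists [set a : 'rV[int]_n | forall i, (`|a 0%R i| <= K)%N]; first exact: finite_int_box.
move=> g g1 gc a aq i /=.
have aE : map_mx (fun z : int => z%:~R) a = lvec a g *m \adj g.
  by rewrite /lvec -mulmxA mul_mx_adj g1 mulmx1.
have : `|((a 0 i)%:~R : R)| <= n%:R * (q * d).
  have -> : (a 0 i)%:~R = (lvec a g *m \adj g) 0 i by rewrite -aE mxE.
  rewrite mxE (le_trans (ler_norm_sum _ _ _)) //.
  rewrite (le_trans (ler_sum _ (G := fun=> q * d) _)) //; last first.
    by rewrite sumr_const card_ord mulr_natl.
  move=> j _; rewrite normrM ler_pM // mxE /cofactor normrMsign.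
  by apply: normr_det_le => i' j'; rewrite !mxE.
rewrite -intr_norm -abszE => h.
have -> : `|a 0%R i|%N = Num.truncn (`|a 0 i|%:~R : R).
  by rewrite -[LHS](@natrK R).
by rewrite /K le_truncn.
Qed.

(** * Right translations of the space of lattices *)

Lemma mx_continuous (R : realType) (T : topologicalType) (m n : nat)
    (f : T -> 'M[R]_(m, n)) (x : T) :
  (forall i j, {for x, continuous (fun y => f y i j)}) -> {for x, continuous f}.
Proof.
move=> fc A [P fP sPA]; have : \forall y \near x, forall i j, P i j (f y i j).
  apply: filter_forall => i; apply: filter_forall => j.
  exact: (fc i j _ (fP i j)).
by rewrite /nbhs /=; apply: filterS => y Py; exact: sPA.
Qed.

Lemma lvec_continuous (R : realType) (n : nat) (a : 'rV[int]_n) :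
  continuous (fun g : 'M[R]_n => lvec a g).
Proof.
move=> g; apply: mx_continuous => i j.
rewrite (_ : (fun y => _) = (fun y : 'M[R]_n => \sum_(l < n) (a i l)%:~R * y l j)); last first.
  by apply/funext => y; rewrite mxE; apply: eq_bigr => l _; rewrite mxE.
apply: continuous_big; first exact: add_continuous.
move=> l _ y; apply: (@continuousM R _ (fun=> _) (fun y : 'M[R]_n => y l j)).
  exact: cst_continuous.
exact: coord_continuous.
Qed.

Lemma mx_of_continuous (R : realType) (n : nat) : continuous (@mx_of R n).
Proof. exact: (@initial_continuous (SLn R n) 'M[R]_n set_val). Qed.

Lemma mx_of_inj (R : realType) (n : nat) : injective (@mx_of R n).
Proof. by move=> x y; exact: val_inj. Qed.

Lemma det_mx_of (R : realType) (n : nat) (g : SLn R n) : \det (mx_of g) = 1.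
Proof. exact: (set_mem (proj2_sig g)). Qed.

Lemma SLmk_subproof (R : realType) (n : nat) (M : 'M[R]_n) :
  \det M = 1 -> M \in @SLset R n.
Proof. by rewrite inE. Qed.

Definition SLmk (R : realType) (n : nat) (M : 'M[R]_n) (h : \det M = 1) : SLn R n :=
  exist _ M (SLmk_subproof h).

Lemma SLmul_subproof (R : realType) (n : nat) (g h : SLn R n) :
  \det (mx_of g *m mx_of h) = 1.
Proof. by rewrite det_mulmx !det_mx_of mulr1. Qed.

(* The acting element comes first: [SLmul h] is right translation by [h]. *)
Definition SLmul (R : realType) (n : nat) (h g : SLn R n) : SLn R n :=
  SLmk (SLmul_subproof g h).

Lemma SLinv_subproof (R : realType) (n : nat) (g : SLn R n) :
  \det (invmx (mx_of g)) = 1.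
Proof. by rewrite det_inv det_mx_of invr1. Qed.

Definition SLinv (R : realType) (n : nat) (g : SLn R n) : SLn R n :=
  SLmk (SLinv_subproof g).

Lemma SL_unit (R : realType) (n : nat) (g : SLn R n) : mx_of g \in unitmx.
Proof. by rewrite unitmxE det_mx_of unitr1. Qed.

Lemma SLmulK (R : realType) (n : nat) (h : SLn R n) : cancel (SLmul h) (SLmul (SLinv h)).
Proof. by move=> g; apply: mx_of_inj; rewrite /= -mulmxA mulmxV ?SL_unit ?mulmx1. Qed.

Lemma SLmulVK (R : realType) (n : nat) (h : SLn R n) : cancel (SLmul (SLinv h)) (SLmul h).
Proof. by move=> g; apply: mx_of_inj; rewrite /= -mulmxA mulVmx ?SL_unit ?mulmx1. Qed.

Lemma SLmul_continuous (R : realType) (n : nat) (h : SLn R n) : continuous (SLmul h).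
Proof.
apply/continuous_comp_initial => g; apply: mx_continuous => i j.
rewrite (_ : (fun y => _) = (fun y : SLn R n => \sum_(l < n) mx_of y i l * mx_of h l j)); last first.
  by apply/funext => y; rewrite /= mxE.
apply: continuous_big; first exact: add_continuous.
move=> l _ y.
apply: (@continuousM R _ (fun y : SLn R n => mx_of y i l) (fun=> _)); last exact: cst_continuous.
apply: (@continuous_comp _ _ _ (@mx_of R n) (fun M : 'M[R]_n => M i l)).
  exact: mx_of_continuous.
exact: coord_continuous.
Qed.

Lemma lvec_SLmul (R : realType) (n : nat) (a : 'rV[int]_n) (g h : SLn R n) :
  lvec a (mx_of (SLmul h g)) = lvec a (mx_of g) *m mx_of h.
Proof. by rewrite /lvec mulmxA. Qed.

Lemma SLmul_measurable (R : realType) (n : nat) (h : SLn R n) :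
  measurable_fun [set: Xsp R n] (SLmul h : Xsp R n -> Xsp R n).
Proof.
apply: (@measurability _ _ (Xsp R n) (Xsp R n) _ _ (@Xgen R n)) => // _ [B [oB gB] <-].
rewrite setTI; apply: sub_gen_smallest; split.
  by move/continuousP: (@SLmul_continuous R n h); apply.
move=> gam g y g1 yE; apply: gB g1 _ => /=.
by rewrite yE mulmxA.
Qed.

(** Turns the image appearing in [right_invariant] into a preimage, the form in which measurability
    and invariance are used. *)
Lemma rmulE (R : realType) (n : nat) (E : set (Xsp R n)) (h : SLn R n) :
  rmul E (mx_of h) = (SLmul (SLinv h) : Xsp R n -> Xsp R n) @^-1` E.
Proof.
apply/seteqP; split => [y [x Ex yE]|y Ey] /=.
  suff -> : SLmul (SLinv h) y = x by [].
  by rewrite -[RHS](SLmulK h); congr SLmul; exact: mx_of_inj.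
exists (SLmul (SLinv h) y) => //.
by have := congr1 (@mx_of R n) (SLmulVK h y) => /= ->.
Qed.

Lemma mu_SLmul (R : realType) (n : nat) (mu : probability (Xsp R n) R)
    (hmu : right_invariant mu) (h : SLn R n) (E : set (Xsp R n)) :
  measurable E -> mu ((SLmul h : Xsp R n -> Xsp R n) @^-1` E) = mu E.
Proof.
move=> mE; rewrite -(hmu (SLinv h) _ mE) rmulE.
by rewrite (_ : SLinv (SLinv h) = h) //; apply: mx_of_inj; rewrite /= invmxK.
Qed.

(** * Measurability of lattice-point counts *)

(* Coding vectors in [nat], where every set is measurable, makes [counting] available
   as a measure. *)
Definition codes (R : realType) (n : nat) (g : 'M[R]_n) (D : set 'rV[R]_n) : set nat :=
  [set pickle a | a in [set a : 'rV[int]_n | primitive a /\ D (lvec a g)]].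

Definition cnt (R : realType) (n : nat) (g : 'M[R]_n) (D : set 'rV[R]_n) : \bar R :=
  counting (codes g D).

Definition open_cube (R : realType) (n : nat) (q : R) : set 'rV[R]_n :=
  [set y | forall i, `|y 0 i| < q].

Lemma lvec_inj (R : realType) (n : nat) (g : 'M[R]_n) :
  \det g = 1 -> injective (fun a => lvec a g).
Proof.
move=> g1; have gu : g \in unitmx by rewrite unitmxE g1 unitr1.
move=> a b /(congr1 (mulmx^~ (invmx g))); rewrite /lvec -!mulmxA mulmxV // !mulmx1.
by move=> /rowP ab; apply/rowP => i; have := ab i; rewrite !mxE => /intr_inj.
Qed.

Lemma prim_lattE (R : realType) (n : nat) (g : 'M[R]_n) (D : set 'rV[R]_n) :
  prim_latt g `&` D = [set lvec a g | a in [set a : 'rV[int]_n | primitive a /\ D (lvec a g)]].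
Proof.
apply/seteqP; split => [v [[a pa ->] Dv]|_ [a [pa Da] <-]]; first by exists a.
by split => //; exists a.
Qed.

Lemma card_codes (R : realType) (n : nat) (g : 'M[R]_n) (D : set 'rV[R]_n) :
  \det g = 1 -> codes g D #= (prim_latt g `&` D).
Proof.
move=> g1; rewrite prim_lattE; apply: (@card_eq_trans _ _ _ _ [set a : 'rV[int]_n | primitive a /\ D (lvec a g)]).
  by apply: inj_card_eq => a b _ _; exact: (pcan_inj pickleK).
by rewrite card_eq_sym; apply: inj_card_eq => a b _ _; exact: lvec_inj.
Qed.

Lemma counting_eqP (T : choiceType) (R : realType) (A : set T) (N : nat) :
  (counting A = N%:R%:E :> \bar R) <-> A #= `I_N.
Proof.
rewrite /counting; case: asboolP => [fA|iA]; last first.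
  by split => // h; case: iA; exists N.
rewrite -{2}(fset_setK fA); split => [[/eqP]|/card_eq_fsetP ->//].
by rewrite eqr_nat => /eqP h; apply/card_eq_fsetP.
Qed.

Lemma counting_card_eq (T U : choiceType) (R : realType) (A : set T) (B : set U) :
  A #= B -> counting A = counting B :> \bar R.
Proof.
move=> AB; case: (pselect (finite_set B)) => [[N BN]|iB].
  by rewrite (proj2 (counting_eqP R B N) BN); apply/counting_eqP/(card_eq_trans AB).
rewrite /counting !asboolF //; apply: contra_not iB => -[N AN].
by exists N; apply: card_eq_trans AN; rewrite card_eq_sym.
Qed.

Lemma cnt_latt (R : realType) (n : nat) (g : 'M[R]_n) (D : set 'rV[R]_n) :
  \det g = 1 -> cnt g D = counting (prim_latt g `&` D).
Proof. by move=> g1; apply: counting_card_eq; exact: card_codes. Qed.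

(** The adjugate is an integer inverse of [gam], so a common divisor of the entries of [a *m gam]
    already divides those of [a]. *)
Lemma primitive_mul (n : nat) (gam : 'M[int]_n) (a : 'rV[int]_n) :
  \det gam = 1 -> primitive a -> primitive (a *m gam).
Proof.
move=> g1 pa d dag; apply: pa => i.
have -> : a = a *m gam *m \adj gam by rewrite -mulmxA mul_mx_adj g1 mulmx1.
rewrite mxE; apply: rpred_sum => j _; exact: dvdz_mulr.
Qed.

Lemma intmxM (R : realType) (n p : nat) (a : 'M[int]_(p, n)) (gam : 'M[int]_n) :
  map_mx (fun z : int => z%:~R : R) (a *m gam) =
  map_mx (fun z : int => z%:~R) a *m @intmx R n gam.
Proof. exact: (map_mxM (intmul (1 : R))). Qed.

Lemma det_adj1 (n : nat) (gam : 'M[int]_n) : \det gam = 1 -> \det (\adj gam) = 1.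
Proof.
by move=> g1; have := congr1 determinant (mul_mx_adj gam); rewrite g1 det_mulmx g1 mul1r det1.
Qed.

Lemma intmx_adjl (R : realType) (n : nat) (gam : 'M[int]_n) :
  \det gam = 1 -> @intmx R n (\adj gam) *m @intmx R n gam = 1%:M.
Proof.
by move=> g1; rewrite -intmxM mul_adj_mx g1 /intmx (map_mx1 (intmul (1 : R))).
Qed.

Lemma intmx_adjr (R : realType) (n : nat) (gam : 'M[int]_n) :
  \det gam = 1 -> @intmx R n gam *m @intmx R n (\adj gam) = 1%:M.
Proof.
by move=> g1; rewrite -intmxM mul_mx_adj g1 /intmx (map_mx1 (intmul (1 : R))).
Qed.

Lemma prim_latt_invariant (R : realType) (n : nat) (gam : 'M[int]_n) (g : 'M[R]_n) :
  \det gam = 1 -> prim_latt (@intmx R n gam *m g) = prim_latt g.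
Proof.
have sub gam' (g' : 'M[R]_n) : \det gam' = 1 ->
    prim_latt (@intmx R n gam' *m g') `<=` prim_latt g'.
  move=> g1 _ [a pa ->]; exists (a *m gam'); first exact: primitive_mul.
  by rewrite intmxM mulmxA.
move=> g1; apply/seteqP; split; first exact: sub.
have {1}-> : g = @intmx R n (\adj gam) *m (@intmx R n gam *m g).
  by rewrite mulmxA intmx_adjl // mul1mx.
exact/sub/det_adj1.
Qed.

(** A lower bound on a count is witnessed by a finite list of vectors. For open [D] this exhibits
    the condition as a union of open conditions. *)
Lemma le_cntP (R : realType) (n : nat) (g : 'M[R]_n) (D : set 'rV[R]_n) (N : nat) :
  (N%:R%:E <= cnt g D)%E <->
  exists2 s : seq nat, uniq s /\ (N <= size s)%N & {in s, forall b, codes g D b}.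
Proof.
rewrite /cnt; split => [|[s [us Ns] sD]].
  rewrite /counting; case: asboolP => [fA|iA _].
    rewrite lee_fin ler_nat => NA; exists (finmap.enum_fset (fset_set (codes g D))).
      by split => //; exact: finmap.fset_uniq.
    by move=> b bs; have := fset_setK fA => <-.
  have [B BA NB] := infinite_set_fset N iA; exists (finmap.enum_fset B).
    by split => //; exact: finmap.fset_uniq.
  by move=> b /BA.
have ss : [set b | b \in s] #= `I_(size s).
  apply/card_set_bijP; exists (index^~ s); split.
  - by move=> b /=; rewrite index_mem.
  - by move=> b c; rewrite !inE /= => bs cs; exact: index_inj.
  - by move=> j /= js; exists (nth 0%N s j); rewrite /= ?mem_nth ?index_uniq.
apply: (@le_trans _ _ (counting [set b | b \in s])).
  by rewrite (proj2 (counting_eqP R _ _) ss) lee_fin ler_nat.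
by apply: (@le_measure _ _ _ (@counting nat R)) => //; rewrite inE.
Qed.

Lemma open_sub_codes (R : realType) (n : nat) (D : set 'rV[R]_n) (s : seq nat) :
  open D -> open [set g : SLn R n | {in s, forall b, codes (mx_of g) D b}].
Proof.
move=> oD; rewrite openE => g /= BD.
have : \forall y \near g, forall b : seq_sub s, codes (mx_of y) D (ssval b).
  apply: (@filter_forall _ (seq_sub s) (fun b => [set y | codes (mx_of y) D (ssval b)]) (nbhs g)) => b.
  have [a [pa Da] ab] := BD _ (ssvalP b).
  have : \forall y \near g, D (lvec a (mx_of y)).
    apply: (@continuous_comp _ _ _ (@mx_of R n) (fun M => lvec a M)).
    - exact: mx_of_continuous.
    - exact: lvec_continuous.
    - by apply: open_nbhs_nbhs; split.
  by apply: filterS => y Dy; exists a.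
by apply: filterS => y By b bB; exact: (By (SeqSub bB)).
Qed.

(** The superlevel set above [x] is the union over naturals [N > x] of the conditions that the count
    is at least [N]. Each of these is open and Gamma-invariant, hence a generator of the
    sigma-algebra. *)
Lemma measurable_cnt_open (R : realType) (n : nat) (D : set 'rV[R]_n) :
  open D -> measurable_fun [set: Xsp R n] (fun g : Xsp R n => cnt (mx_of g) D).
Proof.
move=> oD; apply: (measurability _ (ErealGenOInfty.measurableE R)).
move=> /= _ [_ [x ->]] <-; rewrite setTI.
rewrite (_ : _ @^-1` _ = \bigcup_(N in [set N : nat | x < N%:R])
   [set g : Xsp R n | (N%:R%:E <= cnt (mx_of g) D)%E]); last first.
  apply/seteqP; split => [g|g [N /= xN Ng]] /=; rewrite in_itv /= andbT; last first.
    by apply: lt_le_trans Ng; rewrite lte_fin.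
  rewrite /cnt /counting; case: asboolP => fA.
    rewrite lte_fin => xN; exists (size (finmap.enum_fset (fset_set (codes (mx_of g) D)))) => //=.
    by rewrite asboolT.
  (* An infinite count exceeds every natural number, so any [N] above [x] will do. *)
  move=> _; exists (Num.truncn `|x|).+1; last by rewrite /= asboolF // leey.
  by rewrite /= (le_lt_trans (ler_norm x)) // truncnS_gt.
apply: bigcup_measurable => N _; apply: sub_gen_smallest; split.
  rewrite (_ : mkset _ = \bigcup_(s in [set s : seq nat | uniq s /\ (N <= size s)%N])
     [set g : SLn R n | {in s, forall b, codes (mx_of g) D b}]).
    by apply: bigcup_open => s _; exact: open_sub_codes.
  apply/seteqP; split => [g /= /le_cntP[s us sD]|g [s us sD]]; first by exists s.
  by apply/le_cntP; exists s.
move=> gam g y g1 yE /=; rewrite !cnt_latt ?det_mx_of // yE.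
by rewrite prim_latt_invariant.
Qed.

Notation Borel R n := (g_sigma_algebraType [set U : set 'rV[R]_n | open U]).

Lemma codesP (R : realType) (n : nat) (g : 'M[R]_n) (D : set 'rV[R]_n) (a : 'rV[int]_n) :
  codes g D (pickle a) <-> primitive a /\ D (lvec a g).
Proof.
split => [[b [pb Db]] /(pcan_inj pickleK) <-//|h]; first by exists a.
Qed.

Lemma mx_bounded (R : realType) (m n : nat) (M : 'M[R]_(m, n)) :
  exists c : R, forall i j, `|M i j| <= c.
Proof.
exists (\sum_i \sum_j `|M i j|) => i j.
rewrite (bigD1 i) //= (bigD1 j) //= -addrA lerDl addr_ge0 // ?sumr_ge0 // => k _.
exact: sumr_ge0.
Qed.

Lemma finite_codes (R : realType) (n : nat) (g : 'M[R]_n) (D : set 'rV[R]_n) (q : R) :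
  \det g = 1 -> D `<=` open_cube q -> finite_set (codes g D).
Proof.
move=> g1 Dq; have [c gc] := mx_bounded g; have [F fF FP] := finite_lattice n c q.
apply: (@sub_finite_set _ _ [set pickle a | a in F]); last exact: finite_image.
move=> _ [a [_ Da] <-]; exists a => //.
by apply: (FP g) => // i; apply/ltW/Dq.
Qed.

Lemma codes_bigcup (R : realType) (n : nat) (g : 'M[R]_n) (F : (set 'rV[R]_n)^nat) :
  codes g (\bigcup_k F k) = \bigcup_k codes g (F k).
Proof.
apply/seteqP; split => [_ [a [pa [k _ Fa]] <-]|_ [k _ [a [pa Fa]] <-]].
  by exists k => //; exists a.
by exists a => //; split => //; exists k.
Qed.

(** Together with [codes_bigcup] this makes [D] to [cnt g D] countably additive. *)
Lemma codes_trivIset (R : realType) (n : nat) (g : 'M[R]_n) (F : (set 'rV[R]_n)^nat) :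
  trivIset setT F -> trivIset setT (fun k => codes g (F k)).
Proof.
move=> /trivIsetP tF; apply/trivIsetP => i j _ _ ij.
apply/seteqP; split => // _ [[a [pa Fi] <-]] /codesP[_ Fj].
by have /seteqP[h _] := tF i j I I ij; exact: (h (lvec a g)).
Qed.

Lemma open_cube_open (R : realType) (n : nat) (q : R) : open (@open_cube R n q).
Proof.
rewrite openE => y /= yq.
apply: (@filter_forall _ 'I_n (fun i => [set z : 'rV[R]_n | `|z 0 i| < q]) (nbhs y)) => i.
have h : {for y, continuous (fun z : 'rV[R]_n => `|z 0 i|)}.
  apply: (@continuous_comp _ _ _ (fun z : 'rV[R]_n => z 0 i) (fun x : R => `|x|)).
    exact: coord_continuous.
  exact: norm_continuous.
exact: (h _ (lt_nbhsl (yq i))).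
Qed.

(** Dynkin induction from the open sets, a pi-system. Intersecting with the cube keeps all counts
    finite, so that a complement gives a difference of counts; a disjoint union gives a series. *)
Lemma measurable_cnt (R : realType) (n : nat) (D : set 'rV[R]_n) (q : R) :
  borel_rv D -> D `<=` open_cube q ->
  measurable_fun [set: Xsp R n] (fun g : Xsp R n => cnt (mx_of g) D).
Proof.
move=> bD Dq; rewrite -(setIidl Dq).
pose P (S : set (Borel R n)) :=
  measurable_fun [set: Xsp R n] (fun g : Xsp R n => cnt (mx_of g) (S `&` open_cube q)).
apply: (@dynkin_induction _ (Borel R n) [set U : set 'rV[R]_n | open U] P) bD => //.
- by move=> A B oA oB; exact: openI.
- by rewrite /P setTI; exact: (measurable_cnt_open (@open_cube_open R n q)).
- by move=> A oA; exact: (measurable_cnt_open (openI oA (@open_cube_open R n q))).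
- move=> S _ mS; rewrite /P.
  rewrite (_ : (fun g => _) = (fun g : Xsp R n =>
      cnt (mx_of g) (open_cube q) - cnt (mx_of g) (S `&` open_cube q))%E); last first.
    apply/funext => g.
    have fS A : cnt (mx_of g) (A `&` open_cube q) \is a fin_num.
      by rewrite /cnt /counting asboolT //; apply: (@finite_codes _ _ _ _ q) => //; exact: det_mx_of.
    have -> : cnt (mx_of g) (open_cube q) =
        (cnt (mx_of g) (~` S `&` open_cube q) + cnt (mx_of g) (S `&` open_cube q))%E.
      rewrite /cnt -(@measureU _ _ _ (@counting nat R)) //; last first.
        apply/seteqP; split => // _ [[a [pa [nS _]] <-]] /codesP[_ [aS _]].
        exact: nS.
      congr counting; apply/seteqP; split => [_ [a [pa ac] <-]|_ [] [a [pa [_ ac]] <-]].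
      - by have [aS|aS] := pselect (S (lvec a (mx_of g))); [right|left]; exists a.
      - by exists a.
      - by exists a.
    by rewrite addeK.
  apply: emeasurable_funB => //.
  exact: (measurable_cnt_open (@open_cube_open R n q)).
- move=> F _ tF mF; rewrite /P.
  rewrite (_ : (fun g => _) = (fun g : Xsp R n =>
      \sum_(0 <= k <oo) cnt (mx_of g) (F k `&` open_cube q))%E); last first.
    apply/funext => g; rewrite setI_bigcupl /cnt codes_bigcup.
    rewrite (@measure_bigcup _ _ _ (@counting nat R)) //=.
      by apply: eq_eseriesl => k; rewrite in_setT.
    by apply: codes_trivIset; exact: trivIset_setIr.
  apply: (ge0_emeasurable_sum (P := xpredT)) => [k g _ _|k _]; last exact: mF.
  by rewrite /cnt; exact: measure_ge0.
Qed.

(** * Null sets by averaging *)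

Lemma cvg_sum0 (R : realType) (I : eqType) (s : seq I) (f : I -> R^nat) :
  {in s, forall i, f i @ \oo --> 0} -> (fun M => \sum_(i <- s) f i M) @ \oo --> 0.
Proof.
elim: s => [_|i s IH fs].
  by under eq_fun do rewrite big_nil; exact: cvg_cst.
under eq_fun do rewrite big_cons.
have IHs : (fun M => \sum_(i <- s) f i M) @ \oo --> 0.
  by apply: IH => j js; apply: fs; rewrite inE js orbT.
have := cvgD (fs i (mem_head i s)) IHs; rewrite addr0; exact.
Qed.

(** Each average is bounded by 1 and, by invariance, has integral [mu E]; the averages tend to 0
    pointwise, so dominated convergence applies. *)
Lemma averaging_null (d : measure_display) (X : measurableType d) (R : realType)
    (mu : probability X R) (E : set X) (I : nat -> finType)
    (f : forall M, I M -> X -> X) :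
  measurable E -> (forall M, 0 < #|I M|)%N ->
  (forall M j, measurable (f M j @^-1` E)) ->
  (forall M j, mu (f M j @^-1` E) = mu E) ->
  (forall x, (fun M => (\sum_(j : I M) \1_E (f M j x)) / #|I M|%:R : R) @ \oo --> 0) ->
  mu E = 0%E.
Proof.
move=> mE I0 mf muf cvgf.
pose F M x : \bar R := (\sum_(j : I M) ((#|I M|%:R^-1)%:E * (\1_(f M j @^-1` E) x)%:E))%E.
have FE M x : F M x = ((\sum_(j : I M) \1_E (f M j x)) / #|I M|%:R : R)%:E.
  rewrite /F mulr_suml -sumEFin; apply: eq_bigr => j _.
  by rewrite -EFinM mulrC.
have mind M j : measurable_fun setT (fun x => (\1_(f M j @^-1` E) x : R)%:E).
  by apply/measurable_EFinP/measurable_indic/mf.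
have mFj M j : measurable_fun setT
    (fun x => (#|I M|%:R^-1)%:E * (\1_(f M j @^-1` E) x : R)%:E)%E.
  exact: measurable_funeM.
have mF M : measurable_fun setT (F M) by exact: emeasurable_sum.
have intF M : (\int[mu]_x F M x)%E = mu E.
  rewrite /F ge0_integral_sum //.
  under eq_bigr => j _.
    rewrite ge0_integralZl_EFin ?invr_ge0 //.
    rewrite integral_indic // setIT [X in (_ * X)%E](muf M j); over.
  rewrite -(fineK (fin_num_measure mu _ mE)) -EFinM sumEFin sumr_const -[(_ * _) *+ _]mulr_natl mulrA divff ?mul1r //.
  by rewrite pnatr_eq0 -lt0n I0.
have [] := @dominated_convergence _ _ _ mu setT measurableT F (cst 0%E) (cst 1%E) mF.
- exact: measurable_cst.
- apply: aeW => x _; rewrite (_ : F^~ x = EFin \o (fun M => (\sum_(j : I M) \1_E (f M j x)) / #|I M|%:R : R)).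
    by apply: cvg_EFin; [exact: nearW|exact: cvgf].
  by apply/funext => M /=; rewrite FE.
- exact: (finite_measure_integrable_cst mu 1).
- apply: aeW => x M _; rewrite FE abse_EFin lee_fin ger0_norm; last first.
    by rewrite mulr_ge0 ?invr_ge0 // sumr_ge0.
  rewrite ler_pdivrMr ?ltr0n // mul1r.
  apply: (le_trans (y := \sum_(j : I M) 1)); last by rewrite sumr_const.
  by apply: ler_sum => j _; rewrite indicE; case: (_ \in _).
(* The integrals form the constant sequence [mu E], whose limit must be 0. *)
move=> _ _; rewrite integral0 (_ : [sequence _]_n = cst (mu E)); last first.
  by apply/funext => M; exact: intF.
by move=> h; apply: (cvg_unique _ _ h) => //; exact: cvg_cst.
Qed.

Definition meets (R : realType) (n : nat) (D : set 'rV[R]_n) : set (Xsp R n) :=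
  [set g | exists2 a : 'rV[int]_n, primitive a & D (lvec a (mx_of g))].

Lemma measurable_meets (R : realType) (n : nat) (D : set 'rV[R]_n) (q : R) :
  borel_rv D -> D `<=` open_cube q -> measurable (meets D).
Proof.
move=> bD Dq.
have := emeasurable_fun_c_infty measurableT (measurable_cnt bD Dq) 1%:E.
rewrite setTI (_ : mkset _ = meets D) //; apply/seteqP; split => g /=.
  move=> /(proj1 (le_cntP _ D 1))[[|b s] [//= _ _] /(_ b)].
  by rewrite mem_head => /(_ isT)[a [pa Da] _]; exists a.
move=> [a pa Da]; apply/(le_cntP _ D 1); exists [:: pickle a] => // b.
by rewrite inE => /eqP ->; exists a.
Qed.

Lemma lvec_neq0 (R : realType) (n : nat) (a : 'rV[int]_n) (g : 'M[R]_n) :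
  \det g = 1 -> primitive a -> lvec a g != 0.
Proof.
move=> g1 pa; apply/eqP => a0.
have {a0}a0 : a = 0.
  by apply: (lvec_inj g1); rewrite a0 /lvec map_mx0 mul0mx.
(* The integer 2 divides every entry of the zero vector but is neither 1 nor -1. *)
by have [i| |] := pa 2; rewrite ?a0 ?mxE ?dvdz0.
Qed.

(** Reduces a statement about lattices to one about single vectors: for fixed [g] only finitely many
    primitive [a] can be carried into [D] by any of the translates, and a finite sum of sequences
    tending to 0 tends to 0. *)
Lemma null_criterion (R : realType) (n : nat) (mu : probability (Xsp R n) R)
    (hmu : right_invariant mu) (I : nat -> finType) (h : forall M, I M -> SLn R n)
    (c q : R) (D : set 'rV[R]_n) :
  (forall M, 0 < #|I M|)%N ->
  (forall M j i l, `|mx_of (h M j) i l| <= c) ->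
  borel_rv D -> D `<=` open_cube q ->
  (forall v : 'rV[R]_n, v != 0 ->
    (fun M => (\sum_(j : I M) \1_D (v *m mx_of (h M j))) / #|I M|%:R : R) @ \oo --> 0) ->
  mu (meets D) = 0%E.
Proof.
move=> I0 hc bD Dq cvgD; have mD := measurable_meets bD Dq.
apply: (@averaging_null _ (Xsp R n) _ mu _ I (fun M j => SLmul (h M j))) => //.
- by move=> M j; rewrite -[X in measurable X]setTI; exact: SLmul_measurable.
- by move=> M j; exact: mu_SLmul.
move=> g; have [cg gcg] := mx_bounded (mx_of g).
(* The entries of every product [g h_j] are at most [n cg c], uniformly in [M] and [j]. *)
have [F fF FP] := finite_lattice n (n%:R * (cg * c)) q.
pose s := [seq a <- finmap.enum_fset (fset_set F) | `[< primitive a >]].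
have cvgs : (fun M => \sum_(a <- s) ((\sum_(j : I M) \1_D (lvec a (mx_of g) *m mx_of (h M j)))
    / #|I M|%:R : R)) @ \oo --> 0.
  apply: cvg_sum0 => a; rewrite mem_filter => /andP[/asboolP pa _].
  by apply: cvgD; apply: lvec_neq0 => //; exact: det_mx_of.
apply: (squeeze_cvgr _ (@cvg_cst _ (0 : R) _ _ _) cvgs); apply: nearW => M.
rewrite mulr_ge0 ?invr_ge0 ?sumr_ge0 //=.
(* Union bound: if the lattice of [g h_j] meets [D], then some [a] in [s] contributes 1 to the
   sum. *)
rewrite -mulr_suml ler_pM2r ?invr_gt0 ?ltr0n // exchange_big /=.
apply: ler_sum => j _; rewrite indicE.
case: (boolP (_ \in _)) => [/set_mem[a pa Da]|_]; last by rewrite sumr_ge0.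
have sa : a \in s.
  rewrite mem_filter asboolT //=.
  have Fa : F a.
    apply: (FP (mx_of (SLmul (h M j) g))); first exact: det_mx_of.
      move=> i l; rewrite mxE (le_trans (ler_norm_sum _ _ _)) //.
      apply: (le_trans (y := \sum_(k < n) cg * c)); last by rewrite sumr_const card_ord mulr_natl.
      by apply: ler_sum => k _; rewrite normrM ler_pM.
    by move=> i; apply/ltW/Dq.
  by move: Fa; rewrite -{1}(fset_setK fF).
rewrite (big_rem a sa) /= lvec_SLmul in Da *.
by rewrite indicE mem_set // lerDl sumr_ge0.
Qed.

(** Among the [M+1] equally spaced parameters in the unit interval at most one sends a given vector
    into [D], so the average is at most [1/(M+1)]. *)
Lemma null_of_unique (R : realType) (n : nat) (mu : probability (Xsp R n) R)
    (hmu : right_invariant mu) (h : R -> SLn R n)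
    (c q : R) (D : set 'rV[R]_n) :
  (forall s i l, 0 <= s <= 1 -> `|mx_of (h s) i l| <= c) ->
  borel_rv D -> D `<=` open_cube q ->
  (forall v : 'rV[R]_n, v != 0 -> forall s t, 0 <= s <= 1 -> 0 <= t <= 1 ->
     D (v *m mx_of (h s)) -> D (v *m mx_of (h t)) -> s = t) ->
  mu (meets D) = 0%E.
Proof.
move=> hc bD Dq uD.
have j01 M (j : 'I_M.+1) : 0 <= (j%:R / M.+1%:R : R) <= 1.
  by rewrite divr_ge0 //= ler_pdivrMr // mul1r ler_nat ltnW.
apply: (null_criterion hmu (I := fun M => 'I_M.+1)
  (h := fun M j => h (j%:R / M.+1%:R)) (c := c) _ _ bD Dq).
- by move=> M; rewrite card_ord.
- by move=> M j i l; exact: hc.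
move=> v v0; apply: (squeeze_cvgr _ (@cvg_cst _ (0 : R) _ _ _) (@cvg_harmonic R)).
apply: nearW => M.
rewrite mulr_ge0 ?invr_ge0 ?sumr_ge0 //= card_ord -[leRHS]mul1r ler_pM2r ?invr_gt0 ?ltr0n //.
have [[j Dj]|nD] := pselect (exists j : 'I_M.+1, D (v *m mx_of (h (j%:R / M.+1%:R)))).
  rewrite (bigD1 j) //= big1 ?addr0 => [|i ij]; first by rewrite indicE; case: (_ \in _).
  rewrite indicE memNset // => Di; move: ij.
  have := uD v v0 _ _ (j01 M i) (j01 M j) Di Dj.
  move=> /(mulIf _); rewrite invr_eq0 pnatr_eq0 => /(_ isT)/eqP.
  by rewrite eqr_nat => /eqP/val_inj ->; rewrite eqxx.
by rewrite big1 // => j _; rewrite indicE memNset // => Dj; apply: nD; exists j.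
Qed.

(** * Lebesgue-null sets and equidistribution of grids *)

Lemma cvg_prod (R : realType) (I : Type) (s : seq I) (f : I -> R^nat) (l : I -> R) :
  (forall i, f i @ \oo --> l i) ->
  (fun M => \prod_(i <- s) f i M) @ \oo --> \prod_(i <- s) l i.
Proof.
move=> fl; elim: s => [|i s IH].
  by under eq_fun do rewrite big_nil; rewrite big_nil; exact: cvg_cst.
under eq_fun do rewrite big_cons.
by rewrite big_cons; exact: (cvgM (fl i) IH).
Qed.

Lemma cvg_sumr (R : realType) (I : Type) (s : seq I) (f : I -> R^nat) (l : I -> R) :
  (forall i, f i @ \oo --> l i) ->
  (fun M => \sum_(i <- s) f i M) @ \oo --> \sum_(i <- s) l i.
Proof.
move=> fl; elim: s => [|i s IH].
  by under eq_fun do rewrite big_nil; rewrite big_nil; exact: cvg_cst.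
under eq_fun do rewrite big_cons.
by rewrite big_cons; exact: (cvgD (fl i) IH).
Qed.

(** Subtracting the least element of [J] injects [J] into the integers from 0 to the integer part of
    [L]. The extra 1 counts both endpoints. *)
Lemma card_diam (R : realType) (M : nat) (J : {set 'I_M}) (L : R) :
  0 <= L -> {in J &, forall i j : 'I_M, (i <= j)%N -> (j - i)%:R <= L} ->
  #|J|%:R <= L + 1.
Proof.
move=> L0 JL; have [->|[j0 j0J]] := set_0Vmem J; first by rewrite cards0 addr_ge0.
have [i0 i0J i0min] := @arg_minnP _ j0 (mem J) (fun i : 'I_M => i : nat) j0J.
pose f (j : 'I_M) : 'I_(Num.truncn L).+1 := inord (j - i0)%N.
have fv j : j \in J -> f j = (j - i0)%N :> nat.
  move=> jJ; rewrite inordK // ltnS truncn_ge_nat //.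
  by apply: JL => //; exact: i0min.
have fi : {in J &, injective f}.
  move=> i j iJ jJ /(congr1 val) /=; rewrite !fv // => e; apply: val_inj => /=.
  by have := i0min _ iJ; have := i0min _ jJ; lia.
rewrite (le_trans (y := (Num.truncn L).+1%:R)) //.
  rewrite ler_nat -(card_in_imset fi) -[leqRHS]card_ord.
  exact: max_card.
by rewrite -natr1 lerD2r truncn_le.
Qed.

Definition grid (R : realType) (d M : nat) (f : {ffun 'I_d -> 'I_M.+1}) : 'rV[R]_d :=
  \row_i ((f i)%:R / M.+1%:R).

(** Membership in a box factors over the coordinates, so the proportion of grid points is a product
    of one-dimensional proportions. Indices hitting one side have spread at most
    [(M+1) (b_i - a_i) / |c|], and [card_diam] adds one. *)
Lemma grid_box (R : realType) (d M : nat) (p a b : 'rV[R]_d) (c : R) :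
  c != 0 -> (forall i, a 0 i <= b 0 i) ->
  (\sum_(f : {ffun 'I_d -> 'I_M.+1}) \1_(box_rv a b) (p + c *: grid R f))
     / #|{ffun 'I_d -> 'I_M.+1}|%:R
  <= \prod_(i < d) (`|c|^-1 * (b 0 i - a 0 i) + M.+1%:R^-1).
Proof.
move=> c0 ab; pose P i (j : 'I_M.+1) := a 0 i <= p 0 i + c * (j%:R / M.+1%:R) <= b 0 i.
have cp : 0 < `|c| by rewrite normr_gt0.
under eq_bigr => f _.
  rewrite (_ : \1_(box_rv a b) _ = \prod_(i < d) (P i (f i))%:R :> R); first over.
  rewrite indicE; case: (boolP (_ \in _)) => [/set_mem h|].
    by rewrite big1 // => i _; have := h i; rewrite !mxE /P => ->.
  rewrite notin_setE => /existsNP[i hi]; rewrite (bigD1 i) //=.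
  by move: hi; rewrite !mxE /P => /negP/negbTE ->; rewrite mul0r.
rewrite -(bigA_distr_bigA (fun i j => (P i j)%:R)) card_ffun !card_ord natrX.
rewrite -[X in _ ^+ X]card_ord -prodr_const -prodf_div.
apply: ler_prod => i _; rewrite divr_ge0 ?sumr_ge0 //=.
rewrite ler_pdivrMr ?ltr0n // mulrDl mulVf ?pnatr_eq0 //.
rewrite (_ : \sum_j _ = #|[set j | P i j]%SET|%:R); last first.
  rewrite -sum1_card natr_sum [RHS]big_mkcond /=.
  by apply: eq_bigr => j _; rewrite inE; case: (P i j).
apply: card_diam; first by rewrite !mulr_ge0 ?invr_ge0 ?subr_ge0.
move=> j l; rewrite !inE => /andP[aj jb] /andP[al lb] jl.
rewrite -ler_pdivrMr ?ltr0n // ler_pdivlMl //.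
rewrite (_ : `|c| * _ = `|c * (l%:R / M.+1%:R) - c * (j%:R / M.+1%:R)|); last first.
  rewrite -mulrBr -mulrBl normrM -natrB // [in RHS](@ger0_norm _ (_ / _)) ?divr_ge0 //.
move: aj jb al lb; move: (c * _) (c * _) (a 0 i) (b 0 i) (p 0 i) => x y u w z *.
by rewrite ler_norml; apply/andP; split; lra.
Qed.

Lemma bounded_closed_rv_compact (R : realType) (d : nat) (S : set 'rV[R]_d) :
  bounded_rv S -> closed S -> compact S.
Proof.
move=> [K SK] cS; apply: (@subclosed_compact _ _ [set v : 'rV[R]_d | forall i, `[- K, K]%classic (v ord0 i)]) => //.
  by apply: (@rV_compact R d (fun=> `[- K, K]%classic)) => i; exact: segment_compact.
by move=> v Sv i; rewrite /= in_itv /= -ler_norml; exact: SK.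
Qed.

Lemma open_box (R : realType) (d : nat) (a b : 'rV[R]_d) :
  open [set x : 'rV[R]_d | forall i, a 0 i < x 0 i < b 0 i].
Proof.
rewrite openE => y /= yab.
apply: (@filter_forall _ 'I_d (fun i => [set z : 'rV[R]_d | a 0 i < z 0 i < b 0 i]) (nbhs y)) => i.
have /andP[ay yb] := yab i.
have h : {for y, continuous (fun z : 'rV[R]_d => z 0 i)} by exact: coord_continuous.
near=> z; apply/andP; split; near: z.
  exact: (h _ (lt_nbhsr ay)).
exact: (h _ (lt_nbhsl yb)).
Unshelve. all: by end_near. Qed.

Lemma sum_geometric_half (R : realType) (N : nat) (e : R) :
  \sum_(j < N) e / 2 ^+ j.+1 = e - e / 2 ^+ N.
Proof.
elim: N => [|N IH]; first by rewrite big_ord0 expr0 divr1 subrr.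
rewrite big_ord_recr /= IH exprS invfM.
by move: ((2 ^+ N)^-1 : R) => x; lra.
Qed.

(** Half of [e] pays for the given countable cover. The other half pays for enlarging box [j] to an
    open box at cost [(e/2) / 2^(j+1)], after which compactness applies. *)
Lemma leb_null_finite_cover (R : realType) (d : nat) (S : set 'rV[R]_d) (e : R) :
  compact S -> leb_null S -> 0 < e ->
  exists (N : nat) (a b : nat -> 'rV[R]_d),
    [/\ forall j i, a j 0 i <= b j 0 i,
        S `<=` \bigcup_(j in `I_N) box_rv (a j) (b j) &
        \sum_(j < N) vol_box (a j) (b j) < e].
Proof.
move=> cS nS e0; have e20 : 0 < e / 2 by rewrite divr_gt0.
have [a [b [ab Sab vol]]] := nS _ e20.
(* The volume of the enlarged box tends to that of the original as the margin [1/(M+1)] tends to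
   0. *)
have /choice[del delP] : forall j, exists del : R, 0 < del /\
    \prod_(i < d) (b j 0 i - a j 0 i + del *+ 2) < vol_box (a j) (b j) + (e / 2) / 2 ^+ j.+1.
  move=> j.
  have : (fun M => \prod_(i < d) (b j 0 i - a j 0 i + M.+1%:R^-1 *+ 2)) @ \oo --> vol_box (a j) (b j).
    apply: cvg_prod => i; rewrite -[X in _ --> X]addr0; apply: cvgD; first exact: cvg_cst.
    rewrite -(mul0rn _ 2); exact: cvgMn (@cvg_harmonic R).
  have lt : vol_box (a j) (b j) < vol_box (a j) (b j) + (e / 2) / 2 ^+ j.+1.
    by rewrite ltrDl divr_gt0 // exprn_gt0.
  move=> /cvgr_lt /(_ _ lt) [M _ /(_ M (leqnn _)) h]; exists M.+1%:R^-1; split => //.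
pose a' j : 'rV[R]_d := \row_i (a j 0 i - del j).
pose b' j : 'rV[R]_d := \row_i (b j 0 i + del j).
have := cS; rewrite compact_cover => /(_ nat setT
   (fun j => [set x : 'rV[R]_d | forall i, a' j 0 i < x 0 i < b' j 0 i])).
move=> [||D _ SD].
- by move=> j _; exact: open_box.
- move=> x /Sab[j _ xj]; exists j => // i; have /andP[ax xb] := xj i.
  by have [d0 _] := delP j; rewrite !mxE; apply/andP; split; lra.
(* The subcover is replaced by the initial segment containing it; volumes of initial segments are
   controlled, whatever their length. *)
exists (\max_(j <- finmap.enum_fset D) j).+1, a', b'; split.
- by move=> j i; have [d0 _] := delP j; have := ab j i; rewrite !mxE; lra.
- move=> x /SD[j jD xj]; exists j; first by rewrite /= ltnS; exact: leq_bigmax_seq.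
  by move=> i; have /andP[/ltW -> /ltW ->] := xj i.
move: ((\max_(j <- finmap.enum_fset D) j).+1) => N.
apply: (@le_lt_trans _ _ (\sum_(j < N) (vol_box (a j) (b j) + (e / 2) / 2 ^+ j.+1))).
  apply: ler_sum => j _; apply/ltW; have [_] := delP j; apply: le_lt_trans.
  rewrite le_eqVlt; apply/orP; left; apply/eqP; apply: eq_bigr => i _.
  by rewrite !mxE mulr2n opprB !addrA; lra.
rewrite big_split /= sum_geometric_half.
have := vol N; have : 0 < e / 2 / 2 ^+ N by rewrite divr_gt0 // exprn_gt0.
by lra.
Qed.

(** A finite cover of [S] by boxes of small total volume bounds the proportion through [grid_box],
    whose right-hand side tends to the volume divided by [|c|^d]. *)
Lemma grid_null (R : realType) (d : nat) (S : set 'rV[R]_d) (p : 'rV[R]_d) (c : R) :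
  bounded_rv S -> closed S -> leb_null S -> c != 0 ->
  (fun M => (\sum_(f : {ffun 'I_d -> 'I_M.+1}) \1_S (p + c *: grid R f))
     / #|{ffun 'I_d -> 'I_M.+1}|%:R : R) @ \oo --> 0.
Proof.
move=> bS clS nS c0; have cS := bounded_closed_rv_compact bS clS.
apply/cvgr0Pnorm_lt => e e0; have c0' : 0 < `|c| by rewrite normr_gt0.
(* The factor [|c|^d] compensates for the scaling of the grid by [c]. *)
have [|N [a [b [ab Sab vol]]]] := leb_null_finite_cover cS nS (e := `|c| ^+ d * e).
  by rewrite mulr_gt0 ?exprn_gt0.
have : (fun M => \sum_(j < N) \prod_(i < d) (`|c|^-1 * (b j 0 i - a j 0 i) + M.+1%:R^-1)) @ \oo -->
    \sum_(j < N) \prod_(i < d) (`|c|^-1 * (b j 0 i - a j 0 i) + 0).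
  apply: cvg_sumr => j; apply: cvg_prod => i; apply: cvgD; first exact: cvg_cst.
  exact: cvg_harmonic.
have lt : \sum_(j < N) \prod_(i < d) (`|c|^-1 * (b j 0 i - a j 0 i) + 0) < e.
  under eq_bigr do under eq_bigr do rewrite addr0.
  under eq_bigr do rewrite big_split /= prodr_const card_ord.
  by rewrite -mulr_sumr exprVn ltr_pdivrMl ?exprn_gt0.
move=> /cvgr_lt /(_ _ lt); apply: filterS => M; apply: le_lt_trans.
rewrite ger0_norm ?divr_ge0 ?sumr_ge0 //.
apply: (le_trans (y := \sum_(j < N) (\sum_(f : {ffun 'I_d -> 'I_M.+1})
   \1_(box_rv (a j) (b j)) (p + c *: grid R f)) / #|{ffun 'I_d -> 'I_M.+1}|%:R)); last first.
  by apply: ler_sum => j _; apply: grid_box.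
rewrite -mulr_suml ler_wpM2r ?invr_ge0 // exchange_big /=.
apply: ler_sum => f _; rewrite [leLHS]indicE.
case: (boolP (_ \in _)) => [/set_mem/Sab[j /= jN h]|_]; last by rewrite sumr_ge0.
by rewrite (bigD1 (Ordinal jN)) //= indicE mem_set // lerDl sumr_ge0.
Qed.

(** * Null sets of lattices from shears *)

Definition shear (R : realType) (n : nat) (j : 'I_n) (u : 'rV[R]_n) : 'M[R]_n :=
  1%:M + (delta_mx j 0 : 'cV[R]_n) *m u.

Lemma mul_shear (R : realType) (n : nat) (j : 'I_n) (u v : 'rV[R]_n) :
  v *m shear j u = v + v 0 j *: u.
Proof.
rewrite mulmxDr mulmx1 mulmxA; congr (_ + _).
apply/rowP => i; rewrite !mxE big_ord1 mxE (bigD1 j) //= mxE !eqxx mulr1.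
by rewrite big1 ?addr0 // => l lj; rewrite mxE (negbTE lj) mulr0.
Qed.

(** Since [u_j = 0], column [j] is a unit vector, and the minor left by expanding along it is the
    identity. *)
Lemma det_shear (R : realType) (n : nat) (j : 'I_n) (u : 'rV[R]_n) :
  u 0 j = 0 -> \det (shear j u) = 1.
Proof.
move=> uj.
have shearE i l : shear j u i l = (i == l)%:R + (i == j)%:R * u 0 l.
  by rewrite !mxE big_ord1 !mxE eqxx andbT.
rewrite (expand_det_col _ j) (bigD1 j) //= big1 ?addr0 => [|i ij]; last first.
  by rewrite shearE (negbTE ij) add0r mul0r mul0r.
rewrite shearE eqxx uj mulr0 addr0 mul1r /cofactor addnn -mul2n exprM sqrrN !expr1n mul1r.
rewrite (_ : row' j _ = 1%:M) ?det1 //; apply/matrixP => i l.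
rewrite 2!mxE shearE mxE (inj_eq lift_inj).
by rewrite [lift j i == j]eq_sym (negbTE (neq_lift j i)) mul0r addr0.
Qed.

Lemma normr_shear (R : realType) (n : nat) (j : 'I_n) (u : 'rV[R]_n) i l :
  (forall i, `|u 0 i| <= 1) -> `|shear j u i l| <= 2.
Proof.
move=> u1; rewrite !mxE big_ord1 !mxE.
rewrite (le_trans (ler_normD _ _)) // (_ : (2 : R) = 1 + 1) // lerD //.
  by rewrite normr_nat; case: (_ == _).
by rewrite normrM normr_nat -[leRHS]mul1r ler_pM //; case: (_ && _).
Qed.

(** In the coordinates [Q] the shears translate a vector by [cf v *: s], so its images under grid
    shears form a translated and scaled grid, to which [grid_null] applies. The scale may depend on
    [v] as long as it is nonzero. *)
Lemma shear_null (R : realType) (n d : nat) (mu : probability (Xsp R n) R)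
    (hmu : right_invariant mu) (j : 'I_n) (u : 'rV[R]_d -> 'rV[R]_n)
    (Q : 'rV[R]_n -> 'rV[R]_d) (cf : 'rV[R]_n -> R)
    (S : set 'rV[R]_d) (D : set 'rV[R]_n) (q : R) :
  (forall s, u s 0 j = 0) ->
  (forall s : 'rV[R]_d, (forall l, `|s 0 l| <= 1) -> forall i, `|u s 0 i| <= 1) ->
  (forall (v : 'rV[R]_n) s, v 0 j != 0 -> Q (v + v 0 j *: u s) = Q v + cf v *: s) ->
  (forall v : 'rV[R]_n, v 0 j != 0 -> cf v != 0) ->
  bounded_rv S -> closed S -> leb_null S ->
  borel_rv D -> D `<=` open_cube q ->
  (forall v : 'rV[R]_n, D v -> v 0 j != 0 /\ S (Q v)) ->
  mu (meets D) = 0%E.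
Proof.
move=> uj u1 Qu cf0 bS cS nS bD Dq DS.
apply: (null_criterion hmu (I := fun M => {ffun 'I_d -> 'I_M.+1})
  (h := fun M f => SLmk (det_shear (uj (grid R f)))) (c := 2) _ _ bD Dq).
- by move=> M; rewrite card_ffun !card_ord expn_gt0.
- move=> M f i l; apply: normr_shear; apply: u1 => l'; rewrite mxE.
  by rewrite ger0_norm ?divr_ge0 // ler_pdivrMr // mul1r ler_nat ltnW.
(* Vectors with [v_j = 0] are fixed by every shear, but they lie outside [D]. *)
move=> v v0 /=; have [vj|vj] := eqVneq (v 0 j) 0.
  under eq_fun => M.
    rewrite big1 => [|f _]; last first.
      rewrite mul_shear vj scale0r addr0 indicE memNset // => /DS[].
      by rewrite vj eqxx.
    rewrite mul0r; over.
  exact: cvg_cst.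
have := grid_null (Q v) bS cS nS (cf0 _ vj); apply: squeeze_cvgr; last exact: cvg_cst.
apply: nearW => M; rewrite divr_ge0 ?sumr_ge0 //= ler_wpM2r ?invr_ge0 //.
apply: ler_sum => f _; rewrite !indicE mul_shear -Qu //.
case: (boolP (_ \in D)) => [/set_mem/DS[_ h]|_]; last by case: (_ \in _).
by rewrite mem_set.
Qed.

(** * Borel sets and coordinate hyperplanes *)

Lemma open_borel (R : realType) (n : nat) (D : set 'rV[R]_n) : open D -> borel_rv D.
Proof. by move=> oD; exact: sub_gen_smallest. Qed.

Lemma closed_borel (R : realType) (n : nat) (D : set 'rV[R]_n) : closed D -> borel_rv D.
Proof.
move=> cD; rewrite -(setCK D).
have : measurable (~` D : set (Borel R n)) by exact: open_borel (closed_openC cD).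
exact: measurableC.
Qed.

Lemma borelI (R : realType) (n : nat) (A B : set 'rV[R]_n) :
  borel_rv A -> borel_rv B -> borel_rv (A `&` B).
Proof. exact: (@measurableI _ (Borel R n)). Qed.

(** The open set [O] allows for [hit_time], whose continuity is available only where the last
    coordinate is positive. *)
Lemma borel_preimage (R : realType) (n d : nat) (O : set 'rV[R]_n)
    (f : 'rV[R]_n -> 'rV[R]_d) (A : set 'rV[R]_d) :
  open O -> (forall x, O x -> {for x, continuous f}) -> borel_rv A ->
  borel_rv (O `&` f @^-1` A).
Proof.
move=> oO fc bA.
suff : measurable_fun (O : set (Borel R n)) (f : Borel R n -> Borel R d).
  by apply => //; exact: open_borel.
apply: (@measurability _ _ (Borel R n) (Borel R d) _ _ [set U : set 'rV[R]_d | open U]) => //.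
move=> _ [B oB <-]; apply: open_borel; rewrite openE => x [Ox Bx].
apply: filterI; first exact: open_nbhs_nbhs.
by apply: (fc x Ox); exact: open_nbhs_nbhs.
Qed.

(** The nonzero coordinate [j] is what lets a shear move the point off the hyperplane. *)
Definition coord_strip (R : realType) (n : nat) (q : R) (i j : 'I_n) : set 'rV[R]_n :=
  [set y | [/\ open_cube q y, y 0 j != 0 & y 0 i = 0]].

Lemma open_coord_neq0 (R : realType) (n : nat) (j : 'I_n) :
  open [set y : 'rV[R]_n | y 0 j != 0].
Proof.
apply: (@open_comp _ _ (fun y : 'rV[R]_n => y 0 j) [set x | x != 0]).
  by move=> y _; exact: coord_continuous.
exact: open_neq.
Qed.

Lemma closed_coord_eq0 (R : realType) (n : nat) (i : 'I_n) :
  closed [set y : 'rV[R]_n | y 0 i = 0].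
Proof.
apply: (@closed_comp _ _ (fun y : 'rV[R]_n => y 0 i) [set x | x = 0]).
  by move=> y _; exact: coord_continuous.
exact: closed_eq.
Qed.

Lemma coord_strip_borel (R : realType) (n : nat) (q : R) (i j : 'I_n) :
  borel_rv (coord_strip q i j).
Proof.
rewrite (_ : coord_strip q i j = @open_cube R n q `&` [set y : 'rV[R]_n | y 0 j != 0]
   `&` [set y : 'rV[R]_n | y 0 i = 0]); last first.
  by apply/seteqP; split => y [] // [].
apply: borelI; last exact: closed_borel (@closed_coord_eq0 R n i).
exact: (open_borel (openI (@open_cube_open R n q) (@open_coord_neq0 R n j))).
Qed.

(** The shear with parameter [s] adds [s v_j] to coordinate [i], which then vanishes for at most one
    [s]. For [i = j] the strip is empty. *)
Lemma coord_strip_null (R : realType) (n : nat) (mu : probability (Xsp R n) R)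
    (hmu : right_invariant mu) (q : R) (i j : 'I_n) :
  mu (meets (coord_strip q i j)) = 0%E.
Proof.
have [->|ij] := eqVneq i j.
  rewrite (_ : meets _ = set0) ?measure0 //; apply/seteqP; split => // g [a _ [_]].
  by move=> /eqP h1 h2; case: h1.
have uj s : (s *: delta_mx 0 i : 'rV[R]_n) 0 j = 0.
  by rewrite !mxE eqxx eq_sym (negbTE ij) mulr0.
apply: (null_of_unique hmu (h := fun s => SLmk (det_shear (uj s))) (c := 2) (q := q)).
- move=> s k l /andP[s0 s1]; apply: normr_shear => k'.
  by rewrite !mxE eqxx /= normrM normr_nat -[leRHS]mulr1 ler_pM // ?ger0_norm //; case: (_ == _).
- exact: coord_strip_borel.
- by move=> y [].
move=> v v0 s t _ _; rewrite /= !mul_shear => -[_ h1 h2] [_ _ h3].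
move: h1 h2 h3; rewrite !mxE !eqxx [j == i]eq_sym (negbTE ij) /= !mulr1 !mulr0 addr0.
move=> vj e1 e2; have : v 0 j * s = v 0 j * t by apply: (addrI (v 0 i)); rewrite e1 e2.
by move=> /(mulfI vj).
Qed.

(** * Cones and their boundaries *)

Lemma vpE (R : realType) (k m : nat) (v : 'rV[R]_(k + m + 1)) (i : 'I_k) : vp v 0 i = v 0 (lshift 1 (lshift m i)).
Proof. by rewrite !mxE. Qed.

Lemma vppE (R : realType) (k m : nat) (v : 'rV[R]_(k + m + 1)) (i : 'I_m) : vpp v 0 i = v 0 (lshift 1 (rshift k i)).
Proof. by rewrite !mxE. Qed.

Lemma vnE (R : realType) (k m : nat) (v : 'rV[R]_(k + m + 1)) : vn v = v 0 (rshift (k + m) 0).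
Proof. by rewrite /vn mxE. Qed.

Lemma lastc_wpart (R : realType) (k m : nat) (v : 'rV[R]_(k + m + 1)) : lastc (wpart v) = vn v.
Proof. by rewrite /lastc /wpart row_mxKr. Qed.

Lemma coneE (R : realType) (k m : nat) (A : set 'rV[R]_k) (W : set 'rV[R]_(m + 1)) : W `<=` [set w | 0 < lastc w] ->
  coneC A W = [set y | 0 < vn y] `&` hit_time (m := m) @^-1` A `&` wpart (m := m) @^-1` W.
Proof.
move=> W0; apply/seteqP; split => [y [[a Aa ya] Wy]|y [[/= y0 Ay] Wy]].
  have y0 : 0 < vn y by rewrite -lastc_wpart; exact: W0.
  split => //; split => //=.
  by rewrite /hit_time ya scalerA mulVf ?scale1r // gt_eqF.
by split => //; exists (hit_time y) => //; rewrite /hit_time scalerA divff ?scale1r // gt_eqF.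
Qed.

Lemma cone_cube (R : realType) (k m : nat) (A : set 'rV[R]_k) (W : set 'rV[R]_(m + 1)) : bounded_rv A -> bounded_rv W ->
  exists2 q : R, 0 <= q & coneC A W `<=` open_cube q.
Proof.
(* Coordinates of [y'] are products of an entry bounded by [w] and one bounded by [a]; the others
   are bounded by [w]. Absolute values appear because the bounds in [bounded_rv] carry no sign
   condition, and the final 1 makes the inequality strict. *)
move=> [a Aa] [w Ww]; exists (`|w| * (1 + `|a|) + 1); first by rewrite addr_ge0 ?mulr_ge0 ?addr_ge0.
move=> y [[x Ax yx] Wy] i.
have lew (z : R) : `|z| <= w -> `|z| < `|w| * (1 + `|a|) + 1.
  move=> zw; rewrite ltr_pwDr //; apply: (le_trans zw); apply: (le_trans (ler_norm w)).
  by rewrite ler_peMr // lerDl.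
have yn : `|vn y| <= w by rewrite -lastc_wpart /lastc mxE; exact: Ww.
case: (split_ordP i) => l ->; last first.
  by rewrite ord1 -vnE; exact: lew.
case: (split_ordP l) => p ->; last first.
  by rewrite -vppE; apply: lew; have := Ww _ Wy (lshift 1 p); rewrite /wpart row_mxEl.
rewrite -vpE yx mxE normrM ltr_pwDr //.
rewrite mulrDr mulr1 ler_wpDl // ler_pM //; first exact: le_trans yn (ler_norm w).
exact: le_trans (Aa _ Ax p) (ler_norm a).
Qed.

Lemma vn_continuous (R : realType) (k m : nat) : continuous (@vn R k m).
Proof.
rewrite (_ : @vn R k m = (fun y => y 0 (rshift (k + m) 0))); first exact: coord_continuous.
by apply/funext => y; rewrite vnE.
Qed.

Lemma wpart_continuous (R : realType) (k m : nat) : continuous (@wpart R k m).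
Proof.
move=> y; apply: mx_continuous => i j; rewrite (ord1 i).
case: (split_ordP j) => l ->.
  rewrite (_ : (fun z => _) = (fun z : 'rV[R]_(k + m + 1) => z 0 (lshift 1 (rshift k l)))).
    exact: coord_continuous.
  by apply/funext => z; rewrite /wpart row_mxEl vppE.
rewrite (_ : (fun z => _) = (fun z : 'rV[R]_(k + m + 1) => z 0 (rshift (k + m) l))).
  exact: coord_continuous.
by apply/funext => z; rewrite /wpart row_mxEr mxE.
Qed.

Lemma hit_time_continuous (R : realType) (k m : nat) (y : 'rV[R]_(k + m + 1)) : 0 < vn y -> {for y, continuous (@hit_time R k m)}.
Proof.
move=> y0; apply: mx_continuous => i j; rewrite (ord1 i).
rewrite (_ : (fun z => _) = (fun z => (vn z)^-1 * z 0 (lshift 1 (lshift m j)))); last first.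
  by apply/funext => z; rewrite /hit_time mxE vpE.
apply: continuousM; last exact: coord_continuous.
by apply: continuousV; [rewrite gt_eqF|exact: vn_continuous].
Qed.

Lemma open_vn_gt0 (R : realType) (k m : nat) : open [set y : 'rV[R]_(k + m + 1) | 0 < vn y].
Proof.
apply: (@open_comp _ _ (@vn R k m) [set x | 0 < x]); last exact: open_gt.
by move=> y _; exact: vn_continuous.
Qed.

Lemma cone_borel (R : realType) (k m : nat) (A : set 'rV[R]_k) (W : set 'rV[R]_(m + 1)) :
  borel_rv A -> borel_rv W -> W `<=` [set w | 0 < lastc w] -> borel_rv (coneC A W).
Proof.
move=> bA bW /coneE ->.
have b1 := borel_preimage (@open_vn_gt0 R k m) (@hit_time_continuous R k m) bA.
have b2 := borel_preimage openT (fun y _ => @wpart_continuous R k m y) bW.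
by rewrite setTI in b2; exact: (borelI b1 b2).
Qed.

Lemma closed_boundary_rv (R : realType) (d : nat) (A : set 'rV[R]_d) : closed (boundary_rv A).
Proof.
apply: closedI; first exact: closed_closure.
exact: open_closedC (open_interior _).
Qed.

Lemma closure_sub_closed (T : topologicalType) (A B : set T) :
  closed B -> A `<=` B -> closure A `<=` B.
Proof. by move=> /closure_id cB /closureS; rewrite -cB. Qed.

Lemma bounded_closure_rv (R : realType) (d : nat) (A : set 'rV[R]_d) :
  bounded_rv A -> exists M : R, forall x, closure A x -> forall i, `|x 0 i| <= M.
Proof.
move=> [M AM]; exists M.
suff h : closure A `<=` \bigcap_(i in [set: 'I_d]) [set x : 'rV[R]_d | `|x 0 i| <= M].
  by move=> x /h hx i; exact: hx.
move=> x Ax i _ /=.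
have cM : closed [set x : 'rV[R]_d | `|x 0 i| <= M].
  apply: (@closed_comp _ _ (fun y : 'rV[R]_d => `|y 0 i|) [set x | x <= M]); last exact: closed_le.
  move=> y _; apply: (@continuous_comp _ _ _ (fun z : 'rV[R]_d => z 0 i) (fun x : R => `|x|)).
    exact: coord_continuous.
  exact: norm_continuous.
by move: Ax; apply: (closure_sub_closed cM) => y Ay; exact: AM.
Qed.

Lemma bounded_boundary_rv (R : realType) (d : nat) (A : set 'rV[R]_d) :
  bounded_rv A -> bounded_rv (boundary_rv A).
Proof. by move=> /bounded_closure_rv[M AM]; exists M => x [cx _]; exact: AM. Qed.

(* The boundary of C(A, W) lies in a bounded union of these two shells, with S the
   boundary of A resp. W, and of coordinate strips. *)
Definition hit_shell (R : realType) (k m : nat) (S : set 'rV[R]_k) (q : R) :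
  set 'rV[R]_(k + m + 1) :=
  (@open_cube R (k + m + 1) q `&` [set y | 0 < vn y]) `&` hit_time (m := m) @^-1` S.

Definition wpart_shell (R : realType) (k m : nat) (S : set 'rV[R]_(m + 1)) (j : 'I_(k + m + 1))
    (q : R) : set 'rV[R]_(k + m + 1) :=
  (@open_cube R (k + m + 1) q `&` [set y | y 0 j != 0]) `&` wpart (m := m) @^-1` S.

Lemma hit_shell_borel (R : realType) (k m : nat) (S : set 'rV[R]_k) (q : R) :
  borel_rv S -> borel_rv (@hit_shell R k m S q).
Proof.
move=> bS; apply: (borel_preimage (openI (@open_cube_open R _ q) (@open_vn_gt0 R k m)) _ bS).
by move=> y [_]; exact: hit_time_continuous.
Qed.

Lemma wpart_shell_borel (R : realType) (k m : nat) (S : set 'rV[R]_(m + 1))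
    (j : 'I_(k + m + 1)) (q : R) : borel_rv S -> borel_rv (wpart_shell S j q).
Proof.
move=> bS; apply: (borel_preimage (openI (@open_cube_open R _ q) (@open_coord_neq0 R _ j)) _ bS).
by move=> y _; exact: wpart_continuous.
Qed.

(** These shears are the horospherical matrices: they add [v_n s] to [v'] and fix [v_n], so the hit
    time is translated by exactly [s]. *)
Lemma hit_shell_null (R : realType) (k m : nat) (mu : probability (Xsp R (k + m + 1)) R)
    (hmu : right_invariant mu) (S : set 'rV[R]_k) (q : R) :
  bounded_rv S -> closed S -> leb_null S -> mu (meets (@hit_shell R k m S q)) = 0%E.
Proof.
move=> bS cS nS.
apply: (@shear_null _ _ k _ hmu (rshift (k + m) 0)
  (fun s : 'rV[R]_k => row_mx (row_mx s 0) 0 : 'rV[R]_(k + m + 1))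
  (@hit_time R k m) (fun=> 1) S _ q) => //.
- by move=> s; rewrite row_mxEr mxE.
- move=> s s1 i; case: (split_ordP i) => l ->; last by rewrite row_mxEr mxE normr0.
  by rewrite row_mxEl; case: (split_ordP l) => p ->; rewrite ?row_mxEl ?row_mxEr // mxE normr0.
- move=> v s; rewrite -vnE => v0.
  have e : vn (v + vn v *: row_mx (row_mx s 0) 0) = vn v.
    by rewrite vnE mxE [X in _ + X]mxE row_mxEr mxE mulr0 addr0 -vnE.
  apply/rowP => i; rewrite /hit_time e scale1r [RHS]mxE [X in _ = X + _]mxE vpE.
  rewrite [LHS]mxE vpE mxE [X in _ * (_ + X)]mxE !row_mxEl mulrDr mulKf //.
- by apply: hit_shell_borel; exact: closed_borel.
- by move=> y [[]].
- by move=> v [[_ /= v0] Sv]; split => //; rewrite -vnE gt_eqF.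
Qed.

(** A coordinate [v_j] of [v'] serves as pivot: the shear adds [v_j s] to [(v'', v_n)]. This is why
    the shell demands [v_j != 0]. *)
Lemma wpart_shell_null (R : realType) (k m : nat) (mu : probability (Xsp R (k + m + 1)) R)
    (hmu : right_invariant mu) (S : set 'rV[R]_(m + 1)) (q : R) (i : 'I_k) :
  bounded_rv S -> closed S -> leb_null S ->
  mu (meets (wpart_shell S (lshift 1 (lshift m i)) q)) = 0%E.
Proof.
move=> bS cS nS; set j := lshift 1 (lshift m i).
apply: (@shear_null _ _ (m + 1) _ hmu j
  (fun s => row_mx (row_mx 0 (lsubmx s)) (rsubmx s) : 'rV[R]_(k + m + 1))
  (@wpart R k m) (fun v => v 0 j) S _ q) => //.
- by move=> s; rewrite row_mxEl row_mxEl mxE.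
- move=> s s1 l; case: (split_ordP l) => p ->; last by rewrite row_mxEr mxE.
  by rewrite row_mxEl; case: (split_ordP p) => p' ->; rewrite ?row_mxEl ?row_mxEr mxE // normr0.
- move=> v s _; apply/rowP => l; rewrite /wpart; case: (split_ordP l) => p ->.
    rewrite row_mxEl vppE mxE [X in _ + X]mxE row_mxEl row_mxEr [RHS]mxE row_mxEl vppE.
    by congr (_ + _); rewrite !mxE.
  rewrite row_mxEr [RHS]mxE row_mxEr [LHS]mxE mxE [X in _ + X = _]mxE row_mxEr.
  by congr (_ + _); rewrite !mxE.
- by apply: wpart_shell_borel; exact: closed_borel.
- by move=> y [[]].
- by move=> v [[_ /= v0] Sv].
Qed.

Lemma not_boundary (T : topologicalType) (C : set T) (x : T) :
  ~ (closure C x /\ ~ C° x) -> C° x \/ (~` C)° x.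
Proof.
move=> h; have [ix|nix] := pselect (C° x); first by left.
by right; rewrite interiorC => cx; exact: h.
Qed.

(** Where [v_n > 0] the cone is cut out by the continuous maps [hit_time] and [wpart], so a boundary
    point is sent by one of them to a boundary. Nonzero points with [v_n = 0], or with vanishing
    pivot coordinate [i], fall into coordinate strips. *)
Lemma cone_boundary (R : realType) (k m : nat) (A : set 'rV[R]_k) (W : set 'rV[R]_(m + 1))
    (q : R) (y : 'rV[R]_(k + m + 1)) (i : 'I_k) :
  W `<=` [set w | 0 < lastc w] -> open_cube q y -> boundary_rv (coneC A W) y -> y != 0 ->
  [\/ hit_shell (boundary_rv A) q y,
      wpart_shell (boundary_rv W) (lshift 1 (lshift m i)) q y |
      exists i j, coord_strip q i j y].
Proof.
move=> W0 yq [cy iy] y0.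
have strip j : y 0 j = 0 -> exists i j, coord_strip q i j y.
  move=> yj; have [l yl] : exists l, y 0 l != 0.
    apply: contrapT => /forallNP h; move/eqP: y0; apply; apply/rowP => l.
    by rewrite mxE; apply/eqP; apply: contrapT => /negP; exact: h.
  by exists j, l.
have vn0 : 0 <= vn y.
  have cl : closed [set z : 'rV[R]_(k + m + 1) | 0 <= vn z].
    apply: (@closed_comp _ _ (@vn R k m) [set x | 0 <= x]); last exact: closed_ge.
    by move=> z _; exact: vn_continuous.
  apply: (closure_sub_closed cl _ cy) => z.
  by rewrite coneE // => -[[/ltW]].
have [vy0|vyn0] := eqVneq (vn y) 0.
  by constructor 3; apply: (strip (rshift (k + m) 0)); rewrite -vnE.
have {vn0 vyn0}vpos : 0 < vn y by rewrite lt_neqAle eq_sym vyn0.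
have [yi|yi] := eqVneq (y 0 (lshift 1 (lshift m i))) 0; first by constructor 3; exact: strip yi.
have [bA|nA] := pselect (boundary_rv A (hit_time y)); first by constructor 1.
have [bW|nW] := pselect (boundary_rv W (wpart y)); first by constructor 2.
have nvn : \forall z \near y, 0 < vn z by apply: open_nbhs_nbhs; split => //; exact: open_vn_gt0.
(* If both images are interior, [y] is interior to the cone. Otherwise a whole neighbourhood of [y]
   misses the cone, although [y] is in its closure. *)
exfalso; have [AA|AA] := not_boundary nA; have [WW|WW] := not_boundary nW.
- apply: iy; rewrite coneE // /interior.
  apply: filterI; first apply: filterI => //.
    exact: (hit_time_continuous vpos AA).
  exact: (@wpart_continuous R k m y _ WW).
- have [z [+ Wz]] := cy _ (@wpart_continuous R k m y _ WW).
  by rewrite coneE // => -[_].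
- have [z [+ Az]] := cy _ (hit_time_continuous vpos AA).
  by rewrite coneE // => -[[]].
- have [z [+ Wz]] := cy _ (@wpart_continuous R k m y _ WW).
  by rewrite coneE // => -[_].
Qed.

Lemma borel_boundary (R : realType) (n : nat) (C : set 'rV[R]_n) : borel_rv (boundary_rv C).
Proof. exact: closed_borel (@closed_boundary_rv R n C). Qed.

Lemma measure_sub_null (d : measure_display) (T : measurableType d) (R : realType)
    (mu : probability T R) (A B : set T) :
  measurable A -> measurable B -> A `<=` B -> mu B = 0%E -> mu A = 0%E.
Proof.
move=> mA mB AB B0; apply/eqP; rewrite eq_le measure_ge0 andbT -B0.
by apply: le_measure => //; rewrite inE.
Qed.

Lemma null_bigsetU (d : measure_display) (T : measurableType d) (R : realType)
    (mu : probability T R) (I : Type) (s : seq I) (F : I -> set T) :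
  (forall i, measurable (F i)) -> (forall i, mu (F i) = 0%E) ->
  mu (\big[setU/set0]_(i <- s) F i) = 0%E.
Proof.
move=> mF F0; elim: s => [|i s IH]; first by rewrite big_nil measure0.
have mU : measurable (\big[setU/set0]_(j <- s) F j) by exact: bigsetU_measurable.
by rewrite big_cons; exact: (null_set_setU (mF i) mU (F0 i) IH).
Qed.

(** Nullness of the hit shell enters as a hypothesis because it has two sources: shears when the
    boundary of [A] is Lebesgue null, and the flow [Phi] for norm balls. The index [i0] is the pivot
    for the other shell. *)
Lemma cone_boundary_null (R : realType) (k m : nat) (mu : probability (Xsp R (k + m + 1)) R)
    (hmu : right_invariant mu) (A : set 'rV[R]_k) (W : set 'rV[R]_(m + 1)) (q : R) (i0 : 'I_k) :
  W `<=` [set w | 0 < lastc w] -> bounded_rv W -> leb_null (boundary_rv W) ->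
  mu (meets (@hit_shell R k m (boundary_rv A) q)) = 0%E ->
  boundary_rv (coneC A W) `<=` open_cube q ->
  mu (meets (boundary_rv (coneC A W))) = 0%E.
Proof.
move=> W0 bW nW nA Cq; set n := (k + m + 1)%N.
pose B1 := meets (@hit_shell R k m (boundary_rv A) q).
pose B2 := meets (wpart_shell (boundary_rv W) (lshift 1 (lshift m i0)) q).
pose B3 := \big[setU/set0]_(ij : 'I_n * 'I_n) meets (coord_strip q ij.1 ij.2 : set 'rV[R]_n).
have m1 : measurable B1.
  apply: (measurable_meets (q := q) (hit_shell_borel (m := m) q (@borel_boundary _ _ A))).
  by move=> y [[]].
have m2 : measurable B2.
  apply: (measurable_meets (q := q) (wpart_shell_borel _ q (@borel_boundary _ _ W))).
  by move=> y [[]].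
have ms ij : measurable (meets (coord_strip q ij.1 ij.2 : set 'rV[R]_n)).
  apply: (measurable_meets (q := q) (coord_strip_borel q ij.1 ij.2)).
  by move=> y [].
have m3 : measurable B3 by exact: bigsetU_measurable.
apply: (@measure_sub_null _ _ _ mu _ (B1 `|` B2 `|` B3)).
- exact: measurable_meets (@borel_boundary _ _ _) Cq.
- by do 2 apply: measurableU => //.
- move=> g [a pa Da]; have a0 := lvec_neq0 (det_mx_of g) pa.
  have [h|h|[i [j h]]] := cone_boundary i0 W0 (Cq _ Da) Da a0.
  + by left; left; exists a.
  + by left; right; exists a.
  + by right; rewrite /B3 -bigcup_seq; exists (i, j) => //=; [rewrite mem_index_enum|exists a].
- apply: null_set_setU => //; first exact: measurableU.
    apply: null_set_setU => //.
    exact: (wpart_shell_null hmu q i0 (bounded_boundary_rv bW) (@closed_boundary_rv _ _ _) nW).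
  by apply: null_bigsetU => // ij; exact: coord_strip_null.
Qed.

(** * Boundaries of invariant sets and lattices with prescribed counts *)

Lemma SLlmul_continuous (R : realType) (n : nat) (h : SLn R n) :
  continuous (fun g : SLn R n => SLmul g h).
Proof.
apply/continuous_comp_initial => g; apply: mx_continuous => i j.
rewrite (_ : (fun y => _) = (fun y : SLn R n => \sum_(l < n) mx_of h i l * mx_of y l j)); last first.
  by apply/funext => y; rewrite /= mxE.
apply: continuous_big; first exact: add_continuous.
move=> l _ y.
apply: (@continuousM R _ (fun=> _) (fun y : SLn R n => mx_of y l j)); first exact: cst_continuous.
apply: (@continuous_comp _ _ _ (@mx_of R n) (fun M : 'M[R]_n => M l j)).
  exact: mx_of_continuous.
exact: coord_continuous.
Qed.

Lemma det_intmx (R : realType) (n : nat) (gam : 'M[int]_n) :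
  \det (@intmx R n gam) = (\det gam)%:~R.
Proof. exact: (det_map_mx (intmul (1 : R))). Qed.

(** Left multiplication by the inverse of [gam] is continuous and pulls a neighbourhood inside [E]
    back to one at [y], again inside [E] by invariance. *)
Lemma gamma_inv_interior (R : realType) (n : nat) (E : set (SLn R n)) :
  gamma_inv E -> gamma_inv (E°).
Proof.
move=> gE gam g y g1 yE; rewrite /interior => Eg.
have d1 : \det (@intmx R n (\adj gam)) = 1 by rewrite det_intmx det_adj1.
have gy : SLmul y (SLmk d1) = g.
  by apply: mx_of_inj; rewrite /= yE mulmxA intmx_adjl // mul1mx.
rewrite -gy in Eg; have nE := @SLlmul_continuous R n (SLmk d1) y _ Eg.
suff : nbhs y E by [].
apply: (@filterS _ (nbhs y) _ _ _ _ nE) => z /= Ez.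
apply: (gE gam _ _ g1 _ Ez).
by rewrite /= mulmxA intmx_adjr // mul1mx.
Qed.

(** The interior and the complement of the closure are open and Gamma-invariant, hence
    generators. *)
Lemma measurable_boundaryX (R : realType) (n : nat) (E : set (Xsp R n)) :
  gamma_inv E -> measurable (boundaryX E).
Proof.
move=> gE; rewrite /boundaryX -[closure _]setCK -interiorC.
apply: (@measurableD _ (Xsp R n)).
  apply: (@measurableC _ (Xsp R n)); apply: sub_gen_smallest; split; first exact: open_interior.
  apply: gamma_inv_interior => gam g y g1 yE nE Ey; apply: nE.
  apply: (gE (\adj gam) y g) => //; first exact: det_adj1.
  by rewrite yE mulmxA intmx_adjl // mul1mx.
apply: sub_gen_smallest; split; first exact: open_interior.
exact: gamma_inv_interior.
Qed.

Definition profile (R : realType) (n r : nat) (C : 'I_r -> set 'rV[R]_n) (N : 'I_r -> nat) :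
  set (Xsp R n) :=
  [set g | forall i, cnt (mx_of g) (C i) = (N i)%:R%:E :> \bar R].

Lemma profile_invariant (R : realType) (n r : nat) (C : 'I_r -> set 'rV[R]_n) (N : 'I_r -> nat) :
  gamma_inv (profile C N).
Proof.
move=> gam g y g1 yE Eg i; rewrite -(Eg i) !cnt_latt ?det_mx_of // yE.
by rewrite prim_latt_invariant.
Qed.

Lemma profile_measurable (R : realType) (n r : nat) (C : 'I_r -> set 'rV[R]_n) (N : 'I_r -> nat)
    (q : 'I_r -> R) :
  (forall i, borel_rv (C i)) -> (forall i, C i `<=` open_cube (q i)) ->
  measurable (profile C N).
Proof.
move=> bC Cq.
rewrite (_ : profile C N = \big[setI/setT]_(i < r)
   [set g : Xsp R n | cnt (mx_of g) (C i) = (N i)%:R%:E :> \bar R]); last first.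
  rewrite -bigcap_seq; apply/seteqP; split => g h i /=; first by move=> _; exact: h.
  by apply: h; rewrite /= mem_index_enum.
apply: bigsetI_measurable => i _.
have := measurable_cnt (bC i) (Cq i) measurableT (emeasurable_set1 ((N i)%:R%:E : \bar R)).
by rewrite setTI.
Qed.

(** Near [g] only finitely many [a] can reach [C]. For each primitive one the vector at [g] is
    interior to [C] or to its complement, and continuity preserves this nearby. *)
Lemma codes_near (R : realType) (n : nat) (C : set 'rV[R]_n) (q : R) (g : SLn R n) :
  C `<=` open_cube q -> ~ meets (boundary_rv C) g ->
  \forall y \near g, codes (mx_of y) C = codes (mx_of g) C.
Proof.
move=> Cq nb; have [c gc] := mx_bounded (mx_of g).
(* The margin 1 makes the finite set valid for all matrices close to [g]. *)
have [F fF FP] := finite_lattice n (c + 1) q.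
pose s := finmap.enum_fset (fset_set F).
have near_c : \forall y \near g, forall i j, `|mx_of y i j| <= c + 1.
  apply: (@filter_forall _ 'I_n (fun i => [set y | forall j, `|mx_of y i j| <= c + 1]) (nbhs g)) => i.
  apply: (@filter_forall _ 'I_n (fun j => [set y | `|mx_of y i j| <= c + 1]) (nbhs g)) => j.
  have h : {for g, continuous (fun y : SLn R n => `|mx_of y i j|)}.
    apply: (@continuous_comp _ _ _ (fun y : SLn R n => mx_of y i j) (fun x : R => `|x|)).
      apply: (@continuous_comp _ _ _ (@mx_of R n) (fun M : 'M[R]_n => M i j)).
        exact: mx_of_continuous.
      exact: coord_continuous.
    exact: norm_continuous.
  have lt : `|mx_of g i j| < c + 1 by rewrite ltr_pwDr.
  by apply: (@filterS _ (nbhs g) _ _ _ _ (h _ (lt_nbhsl lt))) => y /= /ltW.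
have near_s : \forall y \near g, forall a : seq_sub s, primitive (ssval a) ->
    (C (lvec (ssval a) (mx_of y)) <-> C (lvec (ssval a) (mx_of g))).
  apply: (@filter_forall _ (seq_sub s) (fun a => [set y | primitive (ssval a) ->
    (C (lvec (ssval a) (mx_of y)) <-> C (lvec (ssval a) (mx_of g)))]) (nbhs g)) => a.
  have [pa|npa] := pselect (primitive (ssval a)); last by apply: nearW.
  have lc : {for g, continuous (fun y : SLn R n => lvec (ssval a) (mx_of y))}.
    apply: (@continuous_comp _ _ _ (@mx_of R n) (fun M => lvec (ssval a) M)).
      exact: mx_of_continuous.
    exact: lvec_continuous.
  have [iC|iC] : C° (lvec (ssval a) (mx_of g)) \/ (~` C)° (lvec (ssval a) (mx_of g)).
    by apply: not_boundary => h; apply: nb; exists (ssval a).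
  - apply: (@filterS _ (nbhs g) _ _ _ _ (lc _ iC)) => y /= Cy _; split => // _.
    exact: (nbhs_singleton iC).
  - apply: (@filterS _ (nbhs g) _ _ _ _ (lc _ iC)) => y /= Cy _; split => // Cg.
    by case: (nbhs_singleton iC).
have inF y a : (forall i j, `|mx_of y i j| <= c + 1) -> C (lvec a (mx_of y)) -> a \in s.
  move=> yc Ca; have : F a.
    apply: (FP (mx_of y)) => //; first exact: det_mx_of.
    by move=> i; exact/ltW/Cq.
  by rewrite -{1}(fset_setK fF).
have gc1 i j : `|mx_of g i j| <= c + 1 by rewrite ler_wpDr.
apply: (@filterS2 _ (nbhs g) _ _ _ _ _ near_c near_s) => y yc ys.
apply/seteqP; split => _ [a [pa Ca] <-]; exists a => //; split => //.
- by have h := inF y a yc Ca; apply/(ys (SeqSub h) pa).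
- by have h := inF g a gc1 Ca; apply/(ys (SeqSub h) pa).
Qed.

(** Off the union all counts are locally constant, so the point is interior to the profile or to its
    complement. *)
Lemma profile_boundary (R : realType) (n r : nat) (C : 'I_r -> set 'rV[R]_n) (N : 'I_r -> nat)
    (q : 'I_r -> R) : (forall i, C i `<=` open_cube (q i)) ->
  boundaryX (profile C N) `<=` \big[setU/set0]_(i < r) meets (boundary_rv (C i)).
Proof.
move=> Cq g [cg ig]; rewrite -bigcup_seq; apply: contrapT => nb.
have near_g : \forall y \near (g : SLn R n), forall i, codes (mx_of y) (C i) = codes (mx_of g) (C i).
  apply: (@filter_forall _ 'I_r (fun i => [set y | codes (mx_of y) (C i) = codes (mx_of g) (C i)])
    (nbhs (g : SLn R n))) => i.
  apply: (codes_near (Cq i)) => h; apply: nb; exists i => //=; exact: mem_index_enum.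
have [Eg|nEg] := pselect (profile C N g).
  by apply: ig; apply: (@filterS _ (nbhs (g : SLn R n)) _ _ _ _ near_g) => y yg i; rewrite /cnt yg; exact: Eg.
have [y [Ey yg]] := cg _ near_g; apply: nEg => i; rewrite /cnt -yg; exact: Ey.
Qed.

Lemma boundaryX_preimage (R : realType) (n : nat) (h : SLn R n) (E : set (Xsp R n)) :
  boundaryX ((SLmul h : Xsp R n -> Xsp R n) @^-1` E) `<=`
  (SLmul h : Xsp R n -> Xsp R n) @^-1` (boundaryX E).
Proof.
move=> g [cg ig]; split.
  move=> B /(@SLmul_continuous R n h g) /cg [y [Ey By]].
  by exists (SLmul h y).
by move=> iE; apply: ig; exact: (@SLmul_continuous R n h g _ iE).
Qed.

(** * The diagonal flow and the limit *)

(** Admissibility is applied to the translate of the profile by [g0], to absorb the conjugation in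
    [phi_set]. By invariance the translate has the same measure, and its boundary is null too. *)
Lemma admissible_profile (R : realType) (k m r : nat)
    (mu lam : probability (Xsp R (k + m + 1)) R) (hmu : right_invariant mu)
    (g0 : SLn R (k + m + 1)) (hlam : admissible mu lam g0)
    (C : 'I_r -> set 'rV[R]_(k + m + 1)) (N : 'I_r -> nat) (q q' : 'I_r -> R) :
  (forall i, borel_rv (C i)) -> (forall i, C i `<=` open_cube (q i)) ->
  (forall i, boundary_rv (C i) `<=` open_cube (q' i)) ->
  (forall i, mu (meets (boundary_rv (C i))) = 0%E) ->
  (fun t : R => lam (phi_set g0 t ((SLmul g0 : Xsp R _ -> Xsp R _) @^-1` profile C N)))
    @ +oo --> mu (profile C N).
Proof.
move=> bC Cq Cq' nC; have mP := profile_measurable N bC Cq.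
have mE (F : set (Xsp R (k + m + 1))) : measurable F ->
    measurable ((SLmul g0 : Xsp R _ -> Xsp R _) @^-1` F).
  by move=> mF; rewrite -[X in measurable X]setTI; exact: SLmul_measurable.
rewrite -(mu_SLmul hmu g0 mP); apply: hlam; first exact: mE.
pose B := \big[setU/set0]_(i < r) meets (boundary_rv (C i)).
have mB i : measurable (meets (boundary_rv (C i))).
  exact: measurable_meets (@borel_boundary _ _ _) (Cq' i).
have mBB : measurable B by exact: bigsetU_measurable.
apply: (@measure_sub_null _ _ _ mu _ ((SLmul g0 : Xsp R _ -> Xsp R _) @^-1` B)).
- apply: measurable_boundaryX => gam g y g1 yE.
  by apply: (profile_invariant (C := C) (N := N) g1); rewrite /= yE mulmxA.
- exact: mE.
- move=> g /boundaryX_preimage; exact: (profile_boundary Cq).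
- by rewrite mu_SLmul //; exact: null_bigsetU.
Qed.

Lemma PhiE (R : realType) (k m : nat) (t : R) (i : 'I_(k + m + 1)) :
  row_mx (row_mx (const_mx (expR (m.+1%:R * t)) : 'rV[R]_k)
     (const_mx (expR (- (k%:R * t))) : 'rV[R]_m))
     (const_mx (expR (- (k%:R * t))) : 'rV[R]_1) 0 i =
  expR ((if (i < k)%N then m.+1%:R else - k%:R) * t).
Proof.
case: (split_ordP i) => j ->; last first.
  rewrite row_mxEr mxE /= ltnNge (leq_trans (leq_addr m k) (leq_addr _ _)) /=.
  by rewrite mulNr.
rewrite row_mxEl; case: (split_ordP j) => p ->; last first.
  by rewrite row_mxEr mxE mulNr.
by rewrite row_mxEl mxE.
Qed.

Lemma mul_Phi (R : realType) (k m : nat) (t : R) (v : 'rV[R]_(k + m + 1)) i :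
  (v *m @Phi R k m t) 0 i = v 0 i * expR ((if (i < k)%N then m.+1%:R else - k%:R) * t).
Proof. by rewrite /Phi mul_mx_diag mxE PhiE. Qed.

Lemma det_Phi (R : realType) (k m : nat) (t : R) : \det (@Phi R k m t) = 1.
Proof.
rewrite /Phi det_diag (eq_bigr _ (fun i _ => PhiE t i)) -expR_sum.
rewrite -mulr_suml big_split_ord /= big_split_ord /= big_ord1.
rewrite (eq_bigr (fun=> m.+1%:R)) => [|i _]; last by rewrite ltn_ord.
rewrite [X in _ + X + _](eq_bigr (fun=> - k%:R)) => [|i _]; last by rewrite ltnNge leq_addr.
rewrite !sumr_const !card_ord ltnNge addn0 leq_addr /=.
(* The exponents add up to [k (m+1) - m k - k = 0]. *)
rewrite (_ : _ + _ = 0) ?mul0r ?expR0 //.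
by rewrite -addrA mulNrn -opprD -mulrSr -!mulrnA mulnC subrr.
Qed.

Lemma PhiK (R : realType) (k m : nat) (t : R) : @Phi R k m t *m @Phi R k m (- t) = 1%:M.
Proof.
rewrite /Phi mulmx_diag -diag_const_mx; congr diag_mx; apply/rowP => i.
by rewrite mxE !PhiE mxE -expRD mulrN subrr expR0.
Qed.

Lemma vn_Phi (R : realType) (k m : nat) (t : R) (v : 'rV[R]_(k + m + 1)) :
  vn (v *m @Phi R k m t) = expR (- (k%:R * t)) * vn v.
Proof.
by rewrite !vnE mul_Phi /= ltnNge addn0 leq_addr /= mulNr mulrC.
Qed.

Lemma vp_Phi (R : realType) (k m : nat) (t : R) (v : 'rV[R]_(k + m + 1)) :
  vp (v *m @Phi R k m t) = expR (m.+1%:R * t) *: vp v.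
Proof.
by apply/rowP => i; rewrite [RHS]mxE !vpE mul_Phi /= ltn_ord mulrC.
Qed.

Lemma wpart_Phi (R : realType) (k m : nat) (t : R) (v : 'rV[R]_(k + m + 1)) :
  wpart (v *m @Phi R k m t) = expR (- (k%:R * t)) *: wpart v.
Proof.
apply/rowP => i; rewrite [RHS]mxE /wpart; case: (split_ordP i) => j ->.
  by rewrite !row_mxEl !vppE mul_Phi /= ltnNge leq_addr /= mulNr mulrC.
by rewrite !row_mxEr (ord1 j) -!/(vn _) vn_Phi.
Qed.

Lemma hit_time_Phi (R : realType) (k m : nat) (t : R) (v : 'rV[R]_(k + m + 1)) :
  hit_time (v *m @Phi R k m t) = expR ((k + m + 1)%:R * t) *: hit_time v.
Proof.
rewrite /hit_time vn_Phi vp_Phi !scalerA; congr (_ *: _).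
rewrite invfM -expRN opprK mulrAC -expRD [LHS]mulrC [RHS]mulrC.
by rewrite -mulrDl -natrD; congr (_ * expR (_%:R * t)); lia.
Qed.

(** The conjugating factors cancel against the translation by [g0], leaving the condition that
    [x g0 Phi(-t)] lies in [E]. *)
Lemma phi_setE (R : realType) (k m : nat) (g0 : SLn R (k + m + 1)) (t : R)
    (E : set (Xsp R (k + m + 1))) :
  phi_set g0 t ((SLmul g0 : Xsp R _ -> Xsp R _) @^-1` E) =
  [set x | E (SLmul (SLmk (@det_Phi R k m (- t))) (SLmul g0 x))].
Proof.
have PhiK' : @Phi R k m (- t) *m @Phi R k m t = 1%:M.
  by rewrite -[X in _ *m @Phi R k m X]opprK PhiK.
apply/seteqP; split => [y [x Ex yE]|y Ey] /=.
  rewrite (_ : SLmul _ _ = SLmul g0 x) //; apply: mx_of_inj => /=.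
  by rewrite yE -!mulmxA (mulmxA (invmx _)) mulVmx ?SL_unit // mul1mx PhiK mulmx1.
exists (SLmul (SLinv g0) (SLmul (SLmk (@det_Phi R k m (- t))) (SLmul g0 y))).
  by rewrite /= SLmulVK.
rewrite /= -!mulmxA (mulmxA (invmx _) (mx_of g0)) mulVmx ?SL_unit // mul1mx.
by rewrite (mulmxA (Phi _ _ _)) PhiK' mul1mx mulmxV ?SL_unit // mulmx1.
Qed.

(** With [t = ln L / k], the matrix [Phi(-t)] multiplies [(v'', v_n)] by [e^(kt) = L] and hit times
    by [e^(-nt) = L^(-n/k)], which undoes both normalisations at once. *)
Lemma hits_inE (R : realType) (k m : nat) (hk : (0 < k)%N) (M : 'M[R]_(k + m + 1)) (L : R)
    (W : set 'rV[R]_(m + 1)) (A : set 'rV[R]_k) :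
  0 < L -> W `<=` [set w | 0 < lastc w] ->
  [set v *m @Phi R k m (- (ln L / k%:R)) | v in hits_in M L W A] =
  prim_latt (M *m @Phi R k m (- (ln L / k%:R))) `&` coneC A W.
Proof.
move=> L0 W0; set t := ln L / k%:R; have k0 : (k%:R : R) != 0 by rewrite pnatr_eq0 -lt0n.
have wE v : wpart (v *m @Phi R k m (- t)) = L *: wpart v.
  by rewrite wpart_Phi mulrN opprK mulrC divfK // lnK.
have hE v : hit_time (v *m @Phi R k m (- t)) = L `^ (- nk k m R) *: hit_time v.
  rewrite hit_time_Phi /powR gt_eqF //; congr (expR _ *: _).
  by rewrite /t /nk mulrN mulNr mulrA [in RHS]mulrAC.
have PhiK' : @Phi R k m (- t) *m @Phi R k m t = 1%:M.
  by rewrite -[X in _ *m @Phi R k m X]opprK PhiK.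
rewrite coneE //; apply/seteqP; split.
  move=> _ [v [[[a pa ->] [w Ww vw]] Av] <-]; split; first by exists a; rewrite ?mulmxA.
  have Ww' : W (wpart (map_mx intr a *m M *m @Phi R k m (- t))).
    by rewrite wE vw scalerA divff ?gt_eqF // scale1r.
  split => //; split => /=; first by rewrite -lastc_wpart; exact: W0.
  by rewrite hE.
move=> _ [[a pa ->] [[/= _ Ah] Wa]]; exists (map_mx intr a *m M); last by rewrite mulmxA.
rewrite mulmxA in Ah Wa; split; last by rewrite -hE.
split; first by exists a.
exists (L *: wpart (map_mx intr a *m M)); first by rewrite -wE.
by rewrite scalerA mulVf ?gt_eqF // scale1r.
Qed.

Lemma card_hits_in (R : realType) (k m : nat) (hk : (0 < k)%N) (M : 'M[R]_(k + m + 1)) (L : R)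
    (W : set 'rV[R]_(m + 1)) (A : set 'rV[R]_k) :
  \det M = 1 -> 0 < L -> W `<=` [set w | 0 < lastc w] ->
  hits_in M L W A #= codes (M *m @Phi R k m (- (ln L / k%:R))) (coneC A W).
Proof.
move=> M1 L0 W0; set t := ln L / k%:R.
apply: (@card_eq_trans _ _ _ _ [set v *m @Phi R k m (- t) | v in hits_in M L W A]).
  rewrite card_eq_sym; apply: inj_card_eq => u v _ _ /(congr1 (mulmx^~ (@Phi R k m t))).
  by rewrite -!mulmxA -[X in _ *m @Phi R k m X]opprK PhiK !mulmx1.
by rewrite hits_inE // card_eq_sym; apply: card_codes; rewrite det_mulmx M1 det_Phi mulr1.
Qed.

Lemma cvg_ln_pinfty (R : realType) (k : nat) (hk : (0 < k)%N) :
  (fun L : R => ln L / k%:R) @ +oo --> +oo.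
Proof.
apply/cvgryPge => a; near=> L.
rewrite ler_pdivlMr ?ltr0n // -ler_expR lnK; near: L.
  exact: nbhs_pinfty_ge.
exact: nbhs_pinfty_gt.
Unshelve. all: by end_near. Qed.

(** The substitution [t = ln L / k], which tends to infinity with [L], turns the limit from
    admissibility into the one for hitting times. Hit shells are assumed null so that the lemma
    covers norm balls as well. *)
Lemma hitting_limit (R : realType) (k m : nat) (hk : (0 < k)%N)
  (W : set 'rV[R]_(m + 1))
  (hWb : bounded_rv W) (hWB : borel_rv W)
  (hWpos : W `<=` [set w | 0 < lastc w]) (hWd : leb_null (boundary_rv W))
  (mu : probability (Xsp R (k + m + 1)) R) (hmu : right_invariant mu)
  (g0 : SLn R (k + m + 1))
  (lam : probability (Xsp R (k + m + 1)) R) (hlam : admissible mu lam g0)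
  (r : nat) (A : 'I_r -> set 'rV[R]_k)
  (hAb : forall i, bounded_rv (A i)) (hAB : forall i, borel_rv (A i))
  (hAd : forall i q, mu (meets (@hit_shell R k m (boundary_rv (A i)) q)) = 0%E)
  (N : 'I_r -> nat) :
  (fun L : R =>
      lam [set x : Xsp R (k + m + 1) | forall i,
             hits_in (mx_of x *m mx_of g0) L W (A i) #= `I_(N i)])
     @ +oo --> mu [set g : Xsp R (k + m + 1) | forall i,
         (prim_latt (mx_of g) `&` coneC (A i) W) #= `I_(N i)].
Proof.
have /choice[q hq] i : exists q, coneC (A i) W `<=` open_cube q.
  by have [q _ hq] := cone_cube (hAb i) hWb; exists q.
have /choice[q' hq'] i : exists q, boundary_rv (coneC (A i) W) `<=` open_cube q.
  have [|K hK] := @bounded_boundary_rv R _ (coneC (A i) W).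
    by exists (q i) => x /hq h j; exact/ltW.
  by exists (K + 1) => x /hK h j; rewrite (le_lt_trans (h j)) // ltrDl.
have bC i : borel_rv (coneC (A i) W) by exact: cone_borel.
have nC i : mu (meets (boundary_rv (coneC (A i) W))) = 0%E.
  exact: (cone_boundary_null hmu (Ordinal hk) hWpos hWb hWd (hAd i (q' i)) (hq' i)).
have lim := admissible_profile hmu hlam (N := N) bC hq hq' nC.
have -> : [set g : Xsp R (k + m + 1) | forall i,
    (prim_latt (mx_of g) `&` coneC (A i) W) #= `I_(N i)] = profile (fun i => coneC (A i) W) N.
  apply/seteqP; split => g /= h i.
    by apply/counting_eqP; rewrite (card_eql (card_codes _ (det_mx_of g))); exact: h.
  by rewrite -(card_eql (card_codes _ (det_mx_of g))); apply/counting_eqP; exact: h.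
have /cvg_trans : (fun L : R => lam [set x : Xsp R (k + m + 1) | forall i,
    hits_in (mx_of x *m mx_of g0) L W (A i) #= `I_(N i)]) @ +oo `=>`
  ((fun t : R => lam (phi_set g0 t ((SLmul g0 : Xsp R _ -> Xsp R _) @^-1`
     profile (fun i => coneC (A i) W) N))) \o (fun L : R => ln L / k%:R)) @ +oo; last first.
  by apply; apply: cvg_comp lim; exact: cvg_ln_pinfty.
(* The two functions of [L] are compared only for [L > 0], where the rescaling makes sense. *)
apply: near_eq_cvg; near=> L; have L0 : 0 < L by near: L; exact: nbhs_pinfty_gt.
rewrite /= phi_setE; congr (lam _); apply/seteqP; split => x /= h i.
  rewrite (card_eql (card_hits_in hk _ (SLmul_subproof x g0) L0 hWpos)).
  by apply/(counting_eqP R); exact: h.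
apply/counting_eqP; have := h i.
by rewrite (card_eql (card_hits_in hk _ (SLmul_subproof x g0) L0 hWpos)).
Unshelve. all: by end_near. Qed.

(** * Norm balls and the first hitting time *)

Lemma nrmZ (R : realType) (d : nat) (nrm : 'rV[R]_d -> R)
  (hnrm : is_norm nrm) (c : R) (x : 'rV[R]_d) : nrm (c *: x) = `|c| * nrm x.
Proof. by case: hnrm => _ h _; exact: h. Qed.

Lemma nrmD (R : realType) (d : nat) (nrm : 'rV[R]_d -> R)
  (hnrm : is_norm nrm) (x y : 'rV[R]_d) : nrm (x + y) <= nrm x + nrm y.
Proof. by case: hnrm => _ _ h; exact: h. Qed.

Lemma nrm0 (R : realType) (d : nat) (nrm : 'rV[R]_d -> R)
  (hnrm : is_norm nrm) : nrm 0 = 0.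
Proof. by rewrite -(scale0r 0) (nrmZ hnrm) normr0 mul0r. Qed.

Lemma nrm_eq0 (R : realType) (d : nat) (nrm : 'rV[R]_d -> R)
  (hnrm : is_norm nrm) (x : 'rV[R]_d) : nrm x = 0 -> x = 0.
Proof. by case: hnrm => h _ _; exact: h. Qed.

Lemma nrm_ge0 (R : realType) (d : nat) (nrm : 'rV[R]_d -> R)
  (hnrm : is_norm nrm) (x : 'rV[R]_d) : 0 <= nrm x.
Proof.
have := nrmD hnrm x (- 1 *: x); rewrite (nrmZ hnrm) normrN1 mul1r scaleN1r subrr (nrm0 hnrm) -mulr2n.
by rewrite pmulrn_lge0.
Qed.

Lemma nrm_le_sum (R : realType) (d : nat) (nrm : 'rV[R]_d -> R)
  (hnrm : is_norm nrm) (x : 'rV[R]_d) : nrm x <= \sum_i `|x 0 i| * nrm (delta_mx 0 i).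
Proof.
rewrite {1}(row_sum_delta x).
elim/big_rec2: _ => [|i u v _ h]; first by rewrite (nrm0 hnrm).
by rewrite (le_trans (nrmD hnrm _ _)) // lerD // (nrmZ hnrm).
Qed.

Lemma nrm_continuous (R : realType) (d : nat) (nrm : 'rV[R]_d -> R)
  (hnrm : is_norm nrm) : continuous nrm.
Proof.
move=> x; suff h e : 0 < e -> \forall y \near x, `|nrm x - nrm y| <= e.
  move=> B /nbhs_ballP[e /= e0 eB]; have e20 : 0 < e / 2 by rewrite divr_gt0.
  apply: (@filterS _ (nbhs x) _ _ _ _ (h _ e20)) => y /= hy; apply: eB.
  by rewrite /ball /= (le_lt_trans hy) // ltr_pdivrMr // ltr_pMr // ltr1n.
move=> e0.
pose S := \sum_(i < d) nrm (delta_mx 0 i).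
have S0 : 0 <= S by apply: sumr_ge0 => i _; exact: (nrm_ge0 hnrm).
(* Adding 1 keeps the denominator positive even when [S = 0], as in dimension 0. *)
have e'0 : 0 < e / (S + 1) by rewrite divr_gt0 // ltr_wpDl.
have near_x : \forall y \near x, forall i, `|x 0 i - (y : 'rV[R]_d) 0 i| <= e / (S + 1).
  apply: (@filter_forall _ 'I_d (fun i => [set y : 'rV[R]_d | `|x 0 i - y 0 i| <= e / (S + 1)]) (nbhs x)) => i.
  have h : {for x, continuous (fun z : 'rV[R]_d => z 0 i)} by exact: coord_continuous.
  apply: (h [set t | `|x 0 i - t| <= e / (S + 1)]); apply/nbhs_ballP.
  by exists (e / (S + 1)) => //= t; rewrite /ball /= => /ltW.
apply: (@filterS _ (nbhs x) _ _ _ _ near_x) => y hy.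
have le (z : 'rV[R]_d) : (forall i, `|z 0 i| <= e / (S + 1)) -> nrm z <= e.
  move=> hz; apply: (le_trans (nrm_le_sum hnrm z)).
  apply: (le_trans (y := \sum_i e / (S + 1) * nrm (delta_mx 0 i))).
    by apply: ler_sum => i _; rewrite ler_wpM2r // (nrm_ge0 hnrm).
  rewrite -mulr_sumr -/S mulrAC ler_pdivrMr ?ltr_wpDl // ler_pM2l // lerDl //.
rewrite ler_norml; apply/andP; split.
  rewrite lerNl opprB lerBlDr -[y in X in X <= _](subrK x) (le_trans (nrmD hnrm _ _)) // lerD2r.
  by apply: le => i; rewrite !mxE distrC.
rewrite lerBlDr -[x in X in X <= _](subrK y) (le_trans (nrmD hnrm _ _)) // lerD2r.
by apply: le => i; rewrite !mxE.
Qed.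

(** Comparison with the l1 norm: on its compact unit sphere, nonempty since [d > 0], [nrm] attains a
    positive minimum [nrm z], and homogeneity bounds the l1 norm on the ball by [X / nrm z]. *)
Lemma bounded_closed_ball (R : realType) (d : nat) (nrm : 'rV[R]_d -> R)
  (hnrm : is_norm nrm) (X : R) : (0 < d)%N -> bounded_rv (closed_ball_n nrm X).
Proof.
move=> d0; pose l1 (x : 'rV[R]_d) := \sum_i `|x 0 i|.
have l1c : continuous l1.
  move=> x; apply: (@continuous_big R 'I_d +%R 0 xpredT _ _ _ (fun i (x : 'rV[R]_d) => `|x 0 i|)).
    exact: add_continuous.
  move=> i _ y; apply: (@continuous_comp _ _ _ (fun z : 'rV[R]_d => z 0 i) (fun x : R => `|x|)).
    exact: coord_continuous.
  exact: norm_continuous.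
have lel1 (x : 'rV[R]_d) i : `|x 0 i| <= l1 x.
  by rewrite /l1 (bigD1 i) //= lerDl sumr_ge0.
have cS : compact [set x | l1 x = 1].
  apply: bounded_closed_rv_compact; first by exists 1 => x <- i; exact: lel1.
  by apply: (@closed_comp _ _ l1 [set x | x = 1]) => [x _|]; [exact: l1c|exact: closed_eq].
have l1Z c x : l1 (c *: x) = `|c| * l1 x.
  by rewrite /l1 mulr_sumr; apply: eq_bigr => i _; rewrite mxE normrM.
have S0 : [set x | l1 x = 1] !=set0.
  exists (delta_mx 0 (Ordinal d0)); rewrite /= /l1 (bigD1 (Ordinal d0)) //= big1.
    by rewrite !mxE !eqxx normr1 addr0.
  by move=> i /negbTE h; rewrite mxE h andbF normr0.
have [|z zS zmin] := EVT_min_rV S0 cS (f := nrm).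
  by apply: continuous_subspaceT => x; exact: (nrm_continuous hnrm).
have z1 : l1 z = 1 by move/set_mem: zS.
have z0 : 0 < nrm z.
  rewrite lt_neqAle (nrm_ge0 hnrm) andbT eq_sym; apply/eqP => /(nrm_eq0 hnrm) z0; move: z1.
  rewrite z0 /l1 big1 => [/eqP|i _]; last by rewrite mxE normr0.
  by rewrite eq_sym oner_eq0.
exists (X / nrm z) => x; rewrite /closed_ball_n /= => xX i; apply: (le_trans (lel1 x i)).
rewrite ler_pdivlMr //; apply: le_trans xX.
have [->|lx] := eqVneq (l1 x) 0; first by rewrite mul0r (nrm_ge0 hnrm).
have l0 : 0 < l1 x by rewrite lt_neqAle eq_sym lx /l1 sumr_ge0.
have : nrm z <= nrm ((l1 x)^-1 *: x).
  by apply: zmin; rewrite inE /= l1Z ger0_norm ?invr_ge0 ?ltW // mulVf.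
by rewrite (nrmZ hnrm) gtr0_norm ?invr_gt0 // ler_pdivlMl.
Qed.

Lemma closed_closed_ball (R : realType) (d : nat) (nrm : 'rV[R]_d -> R)
  (hnrm : is_norm nrm) (X : R) : closed (closed_ball_n nrm X).
Proof.
apply: (@closed_comp _ _ nrm [set x | x <= X]); last exact: closed_le.
by move=> x _; exact: (nrm_continuous hnrm).
Qed.

Lemma boundary_closed_ball (R : realType) (d : nat) (nrm : 'rV[R]_d -> R)
  (hnrm : is_norm nrm) (X : R) :
  boundary_rv (closed_ball_n nrm X) `<=` [set x | nrm x = X].
Proof.
move=> x [cx ix]; have {}cx : nrm x <= X by exact: (closure_sub_closed (@closed_closed_ball R d nrm hnrm X) _ cx).
apply/eqP; rewrite eq_le cx leNgt; apply/negP => xX; apply: ix.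
by apply: (@filterS _ (nbhs x) _ _ _ _ (@nrm_continuous R d nrm hnrm x _ (lt_nbhsl xX))) => y /= /ltW.
Qed.

(* Shears would need the sphere {nrm = X} to be Lebesgue null; the flow Phi(s)
   scales hit times by e^(ns) and so meets it at most once. *)
Lemma ball_shell_null (R : realType) (k m : nat) (nrm : 'rV[R]_k -> R) (hnrm : is_norm nrm)
    (mu : probability (Xsp R (k + m + 1)) R) (hmu : right_invariant mu) (X q : R) :
  0 < X -> mu (meets (@hit_shell R k m (boundary_rv (closed_ball_n nrm X)) q)) = 0%E.
Proof.
move=> X0; apply: (null_of_unique hmu (h := fun s => SLmk (@det_Phi R k m s))
  (c := expR m.+1%:R) (q := q)).
- move=> s i l /andP[s0 s1]; rewrite /= /Phi mxE PhiE.
  have le : expR ((if (i < k)%N then m.+1%:R else - k%:R) * s) <= expR m.+1%:R :> R.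
    rewrite ler_expR; case: ifP => _; first by rewrite ler_piMr.
    by rewrite mulNr (le_trans (y := 0)) // oppr_le0 mulr_ge0.
  case: (i == l); last by rewrite mulr0n normr0 expR_ge0.
  by rewrite mulr1n ger0_norm ?expR_ge0.
- exact: (hit_shell_borel (m := m) q (@borel_boundary _ _ _)).
- by move=> y [[]].
move=> v v0 s t _ _ /= [_ /(boundary_closed_ball hnrm) /= hs] [_ /(boundary_closed_ball hnrm) /= ht].
rewrite hit_time_Phi (nrmZ hnrm) (ger0_norm (expR_ge0 _)) in hs.
rewrite hit_time_Phi (nrmZ hnrm) (ger0_norm (expR_ge0 _)) in ht.
have h0 : nrm (hit_time v) != 0.
  by apply/eqP => h; move: hs; rewrite h mulr0 => hs; rewrite -hs ltxx in X0.
have := hs; rewrite -ht => /(mulIf h0) /expR_inj; apply: mulfI.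
by rewrite pnatr_eq0 addn1.
Qed.

(** Provides the gap needed to pass from strict inequalities to a strict inequality for an
    infimum. *)
Lemma finite_lower_bound (R : realType) (T : choiceType) (S : set T) (f : T -> R) (z : R) :
  finite_set S -> (forall v, S v -> z < f v) ->
  exists2 b : R, z < b & forall v, S v -> b <= f v.
Proof.
move=> fS Sf.
suff [b zb h] : exists2 b : R, z < b &
    {in finmap.enum_fset (fset_set S), forall v, b <= f v}.
  by exists b => // v Sv; apply: h; move: Sv; rewrite -{1}(fset_setK fS).
have : {in finmap.enum_fset (fset_set S), forall v, z < f v}.
  by move=> v vS; apply: Sf; rewrite -(fset_setK fS).
elim: (finmap.enum_fset _) => [|v s IH] zf; first by exists (z + 1); rewrite ?ltrDl.
have [|b zb h] := IH; first by move=> u us; apply: zf; rewrite inE us orbT.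
exists (Num.min b (f v)); first by rewrite lt_min zb zf ?mem_head.
by move=> u; rewrite inE => /orP[/eqP ->|/h bu]; rewrite ge_min ?lexx ?orbT // bu.
Qed.

(** The delicate direction is from no hits to a strict bound, since an infimum of values above [X]
    could equal [X]. Finiteness of the hits in a slightly larger ball excludes this. *)
Lemma first_hit_norm_gt (R : realType) (k m : nat) (hk : (0 < k)%N)
    (nrm : 'rV[R]_k -> R) (hnrm : is_norm nrm) (W : set 'rV[R]_(m + 1))
    (hWb : bounded_rv W) (hWpos : W `<=` [set w | 0 < lastc w])
    (M : 'M[R]_(k + m + 1)) (L X : R) :
  \det M = 1 -> 0 < L ->
  ((L `^ (- nk k m R))%:E * first_hit_norm nrm M L W > X%:E)%E <->
  hits_in M L W (closed_ball_n nrm X) = set0.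
Proof.
move=> M1 L0; set c := L `^ (- nk k m R); have c0 : 0 < c by exact: powR_gt0.
have nc v : nrm (c *: hit_time (m := m) v) = c * nrm (hit_time v).
  by rewrite (nrmZ hnrm) gtr0_norm.
split => [h|h0].
  apply/seteqP; split => // v [hv]; rewrite /closed_ball_n /= nc => vX.
  suff : (X%:E < X%:E)%E by rewrite ltxx.
  apply: (lt_le_trans h); apply: (@le_trans _ _ (c%:E * (nrm (hit_time v))%:E)%E).
    rewrite lee_pmul2l ?lte_fin //; apply: ereal_inf_lbound; by exists v.
  by rewrite -EFinM lee_fin.
pose T := hits_in M L W (closed_ball_n nrm (X + 1)).
have fT : finite_set T.
  have [q _ hq] := cone_cube (bounded_closed_ball hnrm (X + 1) hk) hWb.
  have := card_hits_in hk (closed_ball_n nrm (X + 1)) M1 L0 hWpos.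
  rewrite -/T => /eq_finite_set ->; apply: (finite_codes _ hq).
  by rewrite det_mulmx M1 det_Phi mulr1.
have [v Tv|b Xb hb] := finite_lower_bound (z := X) (f := fun v => c * nrm (hit_time v)) fT.
  rewrite ltNge; apply/negP => vX.
  have : (hits_in M L W (closed_ball_n nrm X)) v.
    by case: Tv => hv _; split => //; rewrite /closed_ball_n /= nc.
  by rewrite h0.
(* Scaled norms are at least [b] for hits in the ball of radius [X + 1] and exceed [X + 1] for all
   others, so [b'] bounds them all. *)
pose b' := Num.min b (X + 1).
have Xb' : X < b' by rewrite lt_min Xb ltrDl ltr01.
apply: (@lt_le_trans _ _ b'%:E); first by rewrite lte_fin.
have -> : b' = c * (c^-1 * b') by rewrite mulrA divff ?mul1r // gt_eqF.
rewrite EFinM lee_pmul2l ?lte_fin //; apply: le_ereal_inf_tmp => _ [v hv <-].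
rewrite lee_fin ler_pdivrMl // ge_min.
have [vX|vX] := leP (c * nrm (hit_time v)) (X + 1).
  by rewrite hb //; split => //; rewrite /closed_ball_n /= nc.
by rewrite (ltW vX) orbT.
Qed.

(** * Limits for hitting counts and for the first hitting time *)

Unset Implicit Arguments. Set Strict Implicit. Set Printing Implicit Defensive.

Theorem theorem7 (R : realType) (k m : nat) (hk : (0 < k)%N)
  (nrm : 'rV[R]_k -> R) (hnrm : is_norm nrm)
  (W : set 'rV[R]_(m + 1))
  (hWb : bounded_rv W) (hWB : borel_rv W) (hWi : interior W !=set0)
  (hWpos : W `<=` [set w | 0 < lastc w]) (hWd : leb_null (boundary_rv W))
  (mu : probability (Xsp R (k + m + 1)) R) (hmu : right_invariant mu)
  (g0 : SLn R (k + m + 1))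
  (lam : probability (Xsp R (k + m + 1)) R) (hlam : admissible mu lam g0)
  (r : nat) (A : 'I_r -> set 'rV[R]_k)
  (hAb : forall i, bounded_rv (A i)) (hAB : forall i, borel_rv (A i))
  (hAd : forall i, leb_null (boundary_rv (A i)))
  (N : 'I_r -> nat) :
  ((fun L : R =>
      lam [set x : Xsp R (k + m + 1) | forall i,
             hits_in (mx_of x *m mx_of g0) L W (A i) #= `I_(N i)])
     @ +oo%R -->
   mu [set g : Xsp R (k + m + 1) | forall i,
         (prim_latt (mx_of g) `&` coneC (A i) W) #= `I_(N i)])
  /\
  (forall X : R, 0 < X ->
    (fun L : R =>
       lam [set x : Xsp R (k + m + 1) |
              ((L `^ (- nk k m R))%:E
                 * first_hit_norm nrm (mx_of x *m mx_of g0) L W > X%:E)%E])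
      @ +oo%R -->
    mu [set g : Xsp R (k + m + 1) |
          prim_latt (mx_of g) `&` coneC (closed_ball_n nrm X) W = set0]).
Proof.
split.
  apply: (hitting_limit hk hWb hWB hWpos hWd hmu hlam hAb hAB) => i q.
  exact: (hit_shell_null hmu q (bounded_boundary_rv (hAb i)) (@closed_boundary_rv _ _ _) (hAd i)).
move=> X X0.
have bB := bounded_closed_ball hnrm X hk.
have BB := closed_borel (closed_closed_ball hnrm (X := X)).
(* The first hitting time exceeds the threshold when the count for the single set
   [closed_ball_n nrm X] is 0. *)
have lim := hitting_limit hk hWb hWB hWpos hWd hmu hlam (r := 1)
  (A := fun=> closed_ball_n nrm X) (fun=> bB) (fun=> BB)
  (fun _ q => ball_shell_null hnrm hmu q X0) (N := fun=> 0%N).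
rewrite (_ : [set g | _ = set0] = [set g : Xsp R (k + m + 1) | forall i : 'I_1,
   (prim_latt (mx_of g) `&` coneC (closed_ball_n nrm X) W) #= `I_0]); last first.
  apply/seteqP; split => g /= => [-> _|/(_ ord0)]; first by rewrite II0 card_eq0.
  by rewrite II0 card_eq0 => /eqP.
apply: cvg_trans lim; apply: near_eq_cvg; near=> L.
have L0 : 0 < L by near: L; exact: nbhs_pinfty_gt.
congr (lam _); apply/seteqP; split => x /= h.
  apply/(first_hit_norm_gt hk hnrm hWb hWpos X (SLmul_subproof x g0) L0).
  by apply/eqP; rewrite -(@card_eq0 _ nat) -II0; exact: (h ord0).
move=> _; rewrite II0 card_eq0; apply/eqP.
exact/(first_hit_norm_gt hk hnrm hWb hWpos X (SLmul_subproof x g0) L0).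
Unshelve. all: by end_near. Qed.
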